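(* Let $p_1,p_2,q$ be distinct primes with $p_1\equiv p_2\equiv -q\equiv1\pmod 4$, $k=\mathbb{Q}(\sqrt{p_1p_2q},i)$, $\mathbb{K}_3=k(\sqrt q)$, and $\epsilon_{p_1p_2q}=x+y\sqrt{p_1p_2q}$ with $x,y\in\mathbb{Z}$. Assume $N(\epsilon_{p_1p_2})=-1$. 1. If $q(x\pm1)$ or $2q(x\pm1)$ is a square in $\mathbb{N}$, then $\kappa_{\mathbb{K}_3}=\langle[\mathcal H_1\mathcal H_3]\rangle$ or $\kappa_{\mathbb{K}_3}=\langle[\mathcal H_1\mathcal H_4]\rangle$. 2. If $x\pm1$ is a square in $\mathbb{N}$, then $\kappa_{\mathbb{K}_3}=\langle[\mathcal H_1\mathcal H_3],[\mathcal H_2\mathcal H_4]\rangle$ or $\kappa_{\mathbb{K}_3}=\langle[\mathcal H_1\mathcal H_4],[\mathcal H_2\mathcal H_3]\rangle$. 3. If $p_1(x\pm1)$ or $2p_1(x\pm1)$ is a square in $\mathbb{N}$, then $\kappa_{\mathbb{K}_3}=\langle[\mathcal H_1\mathcal H_3],[\mathcal H_1\mathcal H_4]\rangle$. 4. If $p_2(x\pm1)$ or $2p_2(x\pm1)$ is a square in $\mathbb{N}$, then $\kappa_{\mathbb{K}_3}=\langle[\mathcal H_1\mathcal H_3],[\mathcal H_2\mathcal H_3]\rangle$.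
   Context: $i=\sqrt{-1}$; $\epsilon_m>1$ is the fundamental unit of $\mathbb{Q}(\sqrt m)$ and $N(\epsilon_m)$ its norm to $\mathbb{Q}$. For integers $c,u$, ''$c(u\pm1)$ is a square in $\mathbb{N}$'' means at least one of $c(u+1)$, $c(u-1)$ is the square of a natural number. Write $p_1=e^2+4f^2$, $p_2=g^2+4h^2$ ($e,f,g,h\in\mathbb{N}$), $\pi_1=e+2if$, $\pi_2=e-2if$, $\pi_3=g+2ih$, $\pi_4=g-2ih$; $\mathcal H_j$ is the prime ideal of $k$ above $\pi_j$ and $[\cdot]$ denotes ideal class in $k$. $\kappa_{\mathbb{K}_3}$ is the kernel of the map $\mathrm{Cl}(k)\to\mathrm{Cl}(\mathbb{K}_3)$ induced by extension of ideals. *)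

(* Defs.v *)
From HB Require Export structures.
From mathcomp Require Export all_boot all_order all_algebra all_field.
From mathcomp Require Export all_classical.

#[export] Set Implicit Arguments.
#[export] Unset Strict Implicit.
#[export] Unset Printing Implicit Defensive.

Export Order.TTheory GRing.Theory Num.Theory.

#[global] Open Scope classical_set_scope.
#[global] Open Scope ring_scope.

(* Number fields are realised as subfields of algC.
   0 is covered by 1 - 1, and closure under inverses by 1 / y (0^-1 = 0). *)
Definition is_subfield (F : set algC) : Prop :=
  [/\ F 1,
      (forall x y, F x -> F y -> F (x - y)) &
      (forall x y, F x -> F y -> F (x / y))].

(* F(S); when F is empty this is Q(S), the prime field of algC being Q. *)
Definition adjoin (F S : set algC) : set algC := smallest is_subfield (F `|` S).

Definition Qadjoin (S : set algC) : set algC := adjoin set0 S.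

Definition ringint (F : set algC) : set algC := [set z | F z /\ z \in Aint].

Definition is_ideal (F I : set algC) : Prop :=
  [/\ I `<=` ringint F,
      I 0,
      (forall x y, I x -> I y -> I (x + y)) &
      (forall a x, ringint F a -> I x -> I (a * x))].

Definition is_nzideal (F I : set algC) : Prop :=
  is_ideal F I /\ exists2 x, I x & x != 0.

Definition is_prime_ideal (F P : set algC) : Prop :=
  [/\ is_ideal F P,
      ~ P 1 &
      forall x y, ringint F x -> ringint F y -> P (x * y) -> P x \/ P y].

Definition scale (a : algC) (I : set algC) : set algC := [set a * x | x in I].

Definition idealM (I J : set algC) : set algC :=
  [set z | exists n (x y : 'I_n -> algC),
     [/\ forall i, I (x i), forall i, J (y i) & z = \sum_(i < n) x i * y i]].

Definition ideal_ext (K I : set algC) : set algC := idealM I (ringint K).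

Definition prime_above (F K : set algC) (a : algC) (P : set algC) : Prop :=
  is_prime_ideal K P /\ P `&` ringint F = scale a (ringint F).

(* Ideal classes are equivalence classes of nonzero integral ideals, I and J
   being equivalent when a I = b J for some nonzero integers a, b of F; the
   class group Cl F is the set of these classes.                             *)
Definition ideal_class (F I : set algC) : set (set algC) :=
  [set J | is_nzideal F J /\
     exists a b, [/\ ringint F a, ringint F b, a != 0, b != 0 &
                     scale a I = scale b J]].

Definition Cl (F : set algC) : set (set (set algC)) :=
  [set C | exists2 I, is_nzideal F I & C = ideal_class F I].

Definition class1 (F : set algC) : set (set algC) := ideal_class F (ringint F).

Definition classM (F : set algC) (C D : set (set algC)) : set (set algC) :=
  [set L | exists I J, [/\ C I, D J & ideal_class F (idealM I J) L]].

Definition is_Cl_subgroup (F : set algC) (G : set (set (set algC))) : Prop :=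
  [/\ G `<=` Cl F,
      G (class1 F),
      (forall C D, G C -> G D -> G (classM F C D)) &
      (forall C D, G C -> Cl F D -> classM F C D = class1 F -> G D)].

Definition Cl_gen (F : set algC) (S : set (set (set algC))) :
    set (set (set algC)) :=
  smallest (is_Cl_subgroup F) S.

Definition class_ext (K : set algC) (C : set (set algC)) : set (set algC) :=
  [set L | exists2 I, C I & ideal_class K (ideal_ext K I) L].

Definition capitulation (F K : set algC) : set (set (set algC)) :=
  [set C | Cl F C /\ class_ext K C = class1 K].

Definition is_unit (F : set algC) (u : algC) : Prop :=
  [/\ ringint F u, u != 0 & ringint F u^-1].

Definition quadfield (m : nat) : set algC := Qadjoin [set sqrtC m%:R].

(* The order on algC is partial: 1 < eps entails that eps is real. *)
Definition is_fundamental_unit (m : nat) (eps : algC) : Prop :=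
  [/\ is_unit (quadfield m) eps,
      1 < eps &
      forall u, is_unit (quadfield m) u ->
        exists n : int, u = eps ^ n \/ u = - eps ^ n].

(* N(a + b sqrt m) = a^2 - m b^2; the value is unique when m is not a square. *)
Definition has_quad_norm (m : nat) (z : algC) (r : rat) : Prop :=
  exists a b : rat,
    z = ratr a + ratr b * sqrtC m%:R /\ r = a ^+ 2 - m%:R * b ^+ 2.

Definition is_square_pm1 (c u : int) : Prop :=
  exists n : nat, c * (u + 1) = (n%:Z) ^+ 2 \/ c * (u - 1) = (n%:Z) ^+ 2.

(* Main.v *)
Require Import Defs.
From mathcomp Require Import ring zify.

(* Write P = p1 p2, d = P q, and let sigma generate Gal(K3 / k).  If an ideal I
   of k becomes principal in K3, generated by alpha, then I^2 is generated in k
   by the norm a of alpha, and alpha^2 = a eta for a unit eta of K3 of relative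
   norm 1.  Norms to the quadratic subfields show that, up to powers of i and
   squares of K3, such an eta is 1 or eps_P: the roots of unity are controlled by
   the imaginary quadratic subfields, every unit of Q(sqrt q) is +-1 or +-2 times
   a square, and 2 = i^3 (1 + i)^2.

   Since eps_P = r + s sqrt P has norm -1, 2 (r + i) eps_P is the square of
   r + i + s sqrt P, and factoring 2 (r + i) in Q(i) shows that A eps_P is, up to
   a power of i, a square in K3, where A = pi1 pi3 or A = pi1 pi4.  Hence a is, up
   to units and squares of k, one of 1, A, P, A P.  As an ideal whose square is
   principal is determined by a generator of its square, kappa is generated by
   [H1 H3] (or [H1 H4]) and [H1 H2 H3 H4].  Finally
   2 (x +- 1) eps_d = (x +- 1 + y sqrt d)^2, so each condition on x +- 1 makes q,
   p1 or p2 a square up to a unit of k; this identifies kappa in each case. *)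

(** * Subfields of algC generated by square roots *)

(** An ideal I of k with I^2 = (a) consists of the integers z such that a divides z^2, because a
    number with integral square is integral. So computations with such ideals reduce to their
    generators modulo units and squares, and no factorisation of ideals is invoked.

    Norm 1 to k is what makes the units tractable: for a real unit r of norm 1 or -1 to k, r^2 is up
    to sign the product of its norms to Q(sqrt q) and Q(sqrt P), so eps_d never enters. The norm to
    Q(sqrt P) is, up to sign, an even power of eps_P, since its norm to Q is 1 while eps_P has norm
    -1.

    The factor P comes from descent: a number of K3 whose square lies in k is in k or becomes so
    after multiplication by sqrt q, and q agrees with P modulo squares of k because P q = d.

    Which of pi1 pi3 and pi1 pi4 is A depends on eps_P, hence the alternatives in the first two
    cases; in the third case both classes capitulate, and in the fourth they coincide in k. *)

Lemma subfield0 F : is_subfield F -> F 0.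
Proof. by case=> F1 FB _; rewrite -(subrr 1); apply: FB. Qed.

Lemma subfield1 F : is_subfield F -> F 1. Proof. by case. Qed.

Lemma subfieldB F (x y : algC) : is_subfield F -> F x -> F y -> F (x - y).
Proof. by case=> _ FB _; apply: FB. Qed.

Lemma subfieldN F (x : algC) : is_subfield F -> F x -> F (- x).
Proof. by move=> sF Fx; rewrite -sub0r; apply: subfieldB => //; apply: subfield0. Qed.

Lemma subfieldD F (x y : algC) : is_subfield F -> F x -> F y -> F (x + y).
Proof. by move=> sF Fx Fy; rewrite -[y]opprK; apply: subfieldB => //; apply: subfieldN. Qed.

Lemma subfield_div F (x y : algC) : is_subfield F -> F x -> F y -> F (x / y).
Proof. by case=> _ _ FV; apply: FV. Qed.

Lemma subfieldV F (x : algC) : is_subfield F -> F x -> F x^-1.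
Proof. by move=> sF Fx; rewrite -div1r; apply: subfield_div => //; apply: subfield1. Qed.

Lemma subfieldM F (x y : algC) : is_subfield F -> F x -> F y -> F (x * y).
Proof. by move=> sF Fx Fy; rewrite -[y]invrK; apply: subfield_div => //; apply: subfieldV. Qed.

Lemma subfieldX F (x : algC) n : is_subfield F -> F x -> F (x ^+ n).
Proof.
move=> sF Fx; elim: n => [|n IHn]; first by rewrite expr0; apply: subfield1.
by rewrite exprS; apply: subfieldM.
Qed.

Lemma subfieldXz F (x : algC) (n : int) : is_subfield F -> F x -> F (x ^ n).
Proof.
move=> sF Fx; case: n => n; first exact: subfieldX.
by rewrite NegzE -exprnN; apply: subfieldV => //; apply: subfieldX.
Qed.

Lemma subfield_nat F n : is_subfield F -> F n%:R.
Proof.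
move=> sF; elim: n => [|n IHn]; first exact: subfield0.
by rewrite -natr1; apply: subfieldD => //; apply: subfield1.
Qed.

Lemma subfield_int F (n : int) : is_subfield F -> F n%:~R.
Proof.
move=> sF; case: n => n; first exact: subfield_nat.
by rewrite NegzE mulrNz; apply: subfieldN => //; apply: subfield_nat.
Qed.

Lemma subfield_Crat F z : is_subfield F -> z \in Crat -> F z.
Proof.
move=> sF /CratP[a ->]; rewrite /ratr; apply: subfield_div => //;
  exact: subfield_int.
Qed.

Lemma subfield_sum F n (z : 'I_n -> algC) :
  is_subfield F -> (forall i, F (z i)) -> F (\sum_i z i).
Proof.
move=> sF Fz; elim/big_ind: _ => //; first exact: subfield0.
by move=> x y; apply: subfieldD.
Qed.

Ltac subfield := repeat match goal with
  | H : is_subfield ?F |- ?F _ => first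
    [ assumption | exact (subfield1 H) | exact (subfield0 H)
    | exact (subfield_nat _ H) | exact (subfield_int _ H)
    | refine (subfieldX _ H _) | refine (subfieldD H _ _)
    | refine (subfieldB H _ _) | refine (subfieldN H _)
    | refine (subfieldM H _ _) | refine (subfieldV H _)
    | refine (subfieldXz _ H _) ]
  end.

Definition Qfield : set algC := [set z | z \in Crat].

Lemma Qfield_subfield : is_subfield Qfield.
Proof.
by split; rewrite /Qfield /= ?rpred1 // => x y ? ?; rewrite ?rpredB ?rpred_div.
Qed.

Definition quadext (F : set algC) (s : algC) : set algC :=
  [set z | exists a b, [/\ F a, F b & z = a + b * s]].

Lemma quadext_base F (s : algC) : is_subfield F -> F `<=` quadext F s.
Proof. by move=> sF z Fz; exists z, 0; split; rewrite ?mul0r ?addr0 //; subfield. Qed.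

Lemma quadext_gen F (s : algC) : is_subfield F -> quadext F s s.
Proof. by move=> sF; exists 0, 1; split; rewrite ?mul1r ?add0r //; subfield. Qed.

Lemma quadext_subfield F (s : algC) :
  is_subfield F -> F (s ^+ 2) -> is_subfield (quadext F s).
Proof.
move=> sF Fs2.
have closedB x y : quadext F s x -> quadext F s y -> quadext F s (x - y).
  move=> [a [b [Fa Fb ->]]] [c [e [Fc Fe ->]]]; exists (a - c), (b - e).
  by split; subfield; ring.
have closedM x y : quadext F s x -> quadext F s y -> quadext F s (x * y).
  move=> [a [b [Fa Fb ->]]] [c [e [Fc Fe ->]]].
  exists (a * c + b * e * s ^+ 2), (a * e + b * c).
  by split; subfield; ring.
split=> //; first by apply: quadext_base; subfield.
move=> x y xF yF; apply: closedM => // {x xF}.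
case: yF => a [b [Fa Fb ->]].
(* [s] may lie in [F], so the norm of a nonzero element can vanish; the element is then [2 * a], and
   its inverse is already in [F]. *)
have [n0|nN0] := eqVneq (a ^+ 2 - b ^+ 2 * s ^+ 2) 0; last first.
  set n := a ^+ 2 - _ in nN0; exists (a / n), (- b / n).
  split; try by rewrite /n; subfield.
  have nE : n = (a + b * s) * (a - b * s) by rewrite /n; ring.
  move: nN0; rewrite nE mulf_eq0 negb_or => /andP[n1 n2].
  by field; rewrite n1 n2.
have/eqP : (a + b * s) * (a - b * s) = 0 by rewrite -n0; ring.
rewrite mulf_eq0 subr_eq0 => /orP[/eqP-> | /eqP <-].
  by rewrite invr0; apply: quadext_base => //; apply: subfield0.
by apply: quadext_base => //; subfield.
Qed.

Lemma adjoin_subfield F S : is_subfield (adjoin F S).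
Proof.
split; first by move=> G [[]].
  by move=> x y Hx Hy G GP; apply: subfieldB; [case: GP | apply: Hx | apply: Hy].
by move=> x y Hx Hy G GP; apply: subfield_div; [case: GP | apply: Hx | apply: Hy].
Qed.

Lemma adjoin_base F S : F `<=` adjoin F S.
Proof. by move=> x Fx G [_]; apply; left. Qed.

Lemma adjoin_gen F S : S `<=` adjoin F S.
Proof. by move=> x Fx G [_]; apply; right. Qed.

Lemma adjoin_min F S G :
  is_subfield G -> F `<=` G -> S `<=` G -> adjoin F S `<=` G.
Proof. by move=> sG FG SG x; apply; split=> // y [/FG|/SG]. Qed.

Lemma adjoin_sqrtE F (s : algC) :
  is_subfield F -> F (s ^+ 2) -> adjoin F [set s] = quadext F s.
Proof.
move=> sF Fs2; apply/seteqP; split.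
  apply: adjoin_min; first exact: quadext_subfield.
    exact: quadext_base.
  by move=> _ ->; apply: quadext_gen.
move=> _ [a [b [Fa Fb ->]]]; have sG := adjoin_subfield F [set s].
by subfield; [apply: adjoin_base | apply: adjoin_base | apply: adjoin_gen].
Qed.

Lemma Qadjoin_sqrtE (s : algC) : s ^+ 2 \in Crat -> Qadjoin [set s] = quadext Qfield s.
Proof.
move=> s2; rewrite -adjoin_sqrtE //; last exact: Qfield_subfield.
apply/seteqP; split; apply: adjoin_min; try exact: adjoin_subfield.
- by move=> ? [].
- exact: adjoin_gen.
- by move=> z zQ; apply: subfield_Crat => //; apply: adjoin_subfield.
- exact: adjoin_gen.
Qed.

Lemma Qadjoin_sqrt2E (s t : algC) : s ^+ 2 \in Crat -> t ^+ 2 \in Crat ->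
  Qadjoin [set s; t] = quadext (quadext Qfield t) s.
Proof.
move=> s2 t2; have sQ := Qfield_subfield.
have sF : is_subfield (quadext Qfield t) by apply: quadext_subfield.
have sG := adjoin_subfield set0 [set s; t].
rewrite -adjoin_sqrtE //; last exact: subfield_Crat.
apply/seteqP; split; apply: adjoin_min; rewrite //.
- exact: adjoin_subfield.
- move=> z [->|->]; first by apply: adjoin_gen.
  by apply: adjoin_base; apply: quadext_gen.
- move=> _ [a [b [Qa Qb ->]]]; rewrite /Qadjoin; subfield.
  + exact: subfield_Crat.
  + exact: subfield_Crat.
  + by apply: adjoin_gen; right.
- by move=> _ ->; apply: adjoin_gen; left.
Qed.

(* The minimal polynomial of c over Q(s) is X^2 - c^2, since c is not in Q(s). *)
Lemma exists_aut_flip (F : set algC) (s : seq algC) (c : algC) :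
  is_subfield F -> {in s, forall x, F x} -> c ^+ 2 \in Crat -> ~ F c ->
  exists nu : {rmorphism algC -> algC},
    {in s, forall x, nu x = x} /\ nu c = - c.
Proof.
move=> sF sub_sF /CratP[m c2] nFc.
have [Qs [QsC [[|c1 s1] // [Dc Ds] genQs]]] := num_field_exists (c :: s).
pose E := <<1 & s1>>%AS.
have EF z : z \in E -> F (QsC z).
  have: {in s1, forall x, F (QsC x)}.
    by move=> x s1x; apply: sub_sF; rewrite -Ds map_f.
  rewrite {}/E; elim/last_ind: s1 z {Ds genQs} => [z _|r x IHr z rF].
    by rewrite /= Fadjoin_nil => /vlineP[a ->];
       rewrite alg_num_field fmorph_rat; apply: subfield_Crat; rewrite ?Crat_rat.
  rewrite /= adjoin_rcons => /Fadjoin_polyP[p /polyOverP Ep ->].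
  rewrite -horner_map horner_coef; apply: subfield_sum => // i; subfield.
    rewrite coef_map; apply: IHr; last exact: Ep.
    by move=> y ry; apply: rF; rewrite mem_rcons inE ry orbT.
  by apply: rF; rewrite mem_rcons mem_head.
have nEc : c1 \notin E by apply/negP => /EF; rewrite Dc.
have c1c1 : c1 ^+ 2 = m%:A.
  by apply: (fmorph_inj QsC); rewrite rmorphXn Dc c2 alg_num_field fmorph_rat.
have rootN : root (minPoly E c1) (- c1).
  have Eq2 : 'X^2 - (c1 ^+ 2)%:P \is a polyOver E.
    by rewrite c1c1 rpredB ?rpredX ?polyOverX // polyOverC memvZ // mem1v.
  have dvd2 : minPoly E c1 %| 'X^2 - (c1 ^+ 2)%:P.
    by apply: minPoly_dvdp => //; rewrite rootE !hornerE subrr.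
  have sz2 : size ('X^2 - (c1 ^+ 2)%:P) = 3 by rewrite size_XnsubC.
  have szmin : size (minPoly E c1) = 3.
    apply/eqP; rewrite eqn_leq -{1}sz2 dvdp_leq //=; last first.
      by rewrite -size_poly_gt0 sz2.
    rewrite size_minPoly; move: nEc; rewrite -adjoin_deg_eq1.
    by rewrite /adjoin_degree; case: (_.-1).
  have := dvdp_size_eqp dvd2; rewrite szmin sz2 eqxx => /esym eqp2.
  by rewrite (eqp_root eqp2) rootE !hornerE sqrrN subrr.
(* The identity of [E], extended by sending [c1] to the other root of its minimal polynomial. *)
pose phi := kHomExtend E \1 c1 (- c1).
have homE1 : kHom E E (\1%VF : 'End(Qs)) by rewrite kHom1.
have root1 : root (map_poly \1%VF (minPoly E c1)) (- c1).
  by rewrite lfun1_poly.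
have phim : monoid_morphism phi.
  apply/kHom_monoid_morphism; rewrite -genQs.
  have -> : <<1 & c1 :: s1>>%VS = <<E; c1>>%VS.
    rewrite -adjoin_rcons; apply: subv_anti.
    by rewrite !adjoin_seqSr // => x; rewrite mem_rcons.
  by apply: (kHomSl (sub1v E)); apply: kHomExtendP.
pose phimM := GRing.isMonoidMorphism.Build _ _ phi phim.
pose phiRM : {rmorphism _ -> _} := HB.pack (fun_of_lfun phi) phimM.
have [nu Dnu] := extend_algC_subfield_aut QsC phiRM.
exists nu; split=> [x|].
  rewrite -Ds => /mapP[z s1z ->]; rewrite -Dnu /= (kHomExtend_id _ _ _) ?id_lfunE //.
  exact: seqv_sub_adjoin.
by rewrite -Dc -Dnu /= (kHomExtend_val homE1 root1) rmorphN.
Qed.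

(** * Ideals and ideal classes *)

Lemma ringintD F (x y : algC) : is_subfield F ->
  ringint F x -> ringint F y -> ringint F (x + y).
Proof. by move=> sF [? ?] [? ?]; split; [subfield | rewrite rpredD]. Qed.

Lemma ringintB F (x y : algC) : is_subfield F ->
  ringint F x -> ringint F y -> ringint F (x - y).
Proof. by move=> sF [? ?] [? ?]; split; [subfield | rewrite rpredB]. Qed.

Lemma ringintM F (x y : algC) : is_subfield F ->
  ringint F x -> ringint F y -> ringint F (x * y).
Proof. by move=> sF [? ?] [? ?]; split; [subfield | rewrite rpredM]. Qed.

Lemma ringint_int F (n : int) : is_subfield F -> ringint F n%:~R.
Proof. by move=> sF; split; [subfield | rewrite Aint_int]. Qed.

Lemma ringint_nat F (n : nat) : is_subfield F -> ringint F n%:R.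
Proof. exact: (@ringint_int F n). Qed.

Lemma ringint1 F : is_subfield F -> ringint F 1.
Proof. exact: (@ringint_nat F 1). Qed.

Lemma ringint0 F : is_subfield F -> ringint F 0.
Proof. exact: (@ringint_nat F 0). Qed.

Lemma ringint_sub (F K : set algC) : F `<=` K -> ringint F `<=` ringint K.
Proof. by move=> FK x [/FK]. Qed.

(** Substituting X^2 into the minimal polynomial of [z ^+ 2] gives a monic integral polynomial that
    vanishes at [z]. *)
Lemma Aint_sqr (z : algC) : z ^+ 2 \in Aint -> z \in Aint.
Proof.
move=> z2; pose p := minCpoly (z ^+ 2).
have pZ : p \is a polyOver Num.int by move: z2; rewrite unfold_in.
have [p0 [Dp mon_p] _] := minCpolyP (z ^+ 2).
apply: (@root_monic_Aint (p \Po 'X^2)).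
- by apply/rootP; rewrite horner_comp hornerXn; apply/rootP; apply: root_minCpoly.
- rewrite monicE lead_coef_comp ?size_polyXn //.
  by rewrite /p Dp lead_coef_map (monicP mon_p) lead_coefXn rmorph1 expr1n mulr1.
- by apply: polyOver_comp => //; rewrite rpredX ?polyOverX.
Qed.

Lemma ringint_sqr F (z : algC) : F z -> z ^+ 2 \in Aint -> ringint F z.
Proof. by move=> Fz /Aint_sqr. Qed.

Lemma ideal0 F I : is_ideal F I -> I 0. Proof. by case. Qed.

Lemma idealD F I (x y : algC) : is_ideal F I -> I x -> I y -> I (x + y).
Proof. by case=> _ _ ID _; apply: ID. Qed.

Lemma ideal_mul F I (a x : algC) : is_ideal F I -> ringint F a -> I x -> I (a * x).
Proof. by case=> _ _ _ IM; apply: IM. Qed.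

Lemma ideal_int F I (x : algC) : is_ideal F I -> I x -> ringint F x.
Proof. by case=> IO _ _ _; apply: IO. Qed.

Lemma ringint_ideal F : is_subfield F -> is_ideal F (ringint F).
Proof.
move=> sF; split=> //; first exact: ringint0.
  by move=> x y; apply: ringintD.
by move=> x y; apply: ringintM.
Qed.

Lemma ringint_nzideal F : is_subfield F -> is_nzideal F (ringint F).
Proof.
move=> sF; split; first exact: ringint_ideal.
by exists 1; [apply: ringint1 | rewrite oner_eq0].
Qed.

Lemma idealM_mem I J (x y : algC) : I x -> J y -> idealM I J (x * y).
Proof.
move=> Ix Jy; exists 1%N, (fun=> x), (fun=> y).
by split=> //; rewrite big_ord1.
Qed.

Lemma idealM0 I J : idealM I J 0.
Proof.
exists 0%N, (fun=> 0), (fun=> 0); split; [by case | by case |].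
by rewrite big_ord0.
Qed.

Lemma idealMD I J (x y : algC) :
  idealM I J x -> idealM I J y -> idealM I J (x + y).
Proof.
move=> [m [a [b [Ia Jb ->]]]] [n [c [e [Ic Je ->]]]].
exists (m + n)%N.
exists (fun i => match fintype.split i with inl j => a j | inr j => c j end).
exists (fun i => match fintype.split i with inl j => b j | inr j => e j end).
split; try by move=> i; case: (fintype.split i).
rewrite big_split_ord /=; congr (_ + _); apply: eq_bigr => i _.
  by rewrite (unsplitK (inl i)).
by rewrite (unsplitK (inr i)).
Qed.

Lemma idealM_min I J (S : set algC) :
    S 0 -> (forall x y, S x -> S y -> S (x + y)) ->
    (forall x y, I x -> J y -> S (x * y)) ->
  idealM I J `<=` S.
Proof.
by move=> S0 SD SM _ [n [x [y [Ix Jy ->]]]]; elim/big_ind: _ => // i _; apply: SM.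
Qed.

Lemma idealMC I J : idealM I J = idealM J I.
Proof.
apply/seteqP; split; apply: idealM_min; try exact: idealM0;
  by [move=> x y; apply: idealMD | move=> x y ? ?; rewrite mulrC; apply: idealM_mem].
Qed.

Lemma idealM_subA I J L : idealM (idealM I J) L `<=` idealM I (idealM J L).
Proof.
apply: idealM_min => [|x y|x z xIJ Lz]; [exact: idealM0 | exact: idealMD |].
move: x xIJ; apply: idealM_min => [|x y|x y Ix Jy].
- by rewrite mul0r; apply: idealM0.
- by rewrite mulrDl; apply: idealMD.
- by rewrite -mulrA; do 2!apply: idealM_mem => //.
Qed.

Lemma idealMA I J L : idealM I (idealM J L) = idealM (idealM I J) L.
Proof.
apply/seteqP; split; last exact: idealM_subA.
by rewrite idealMC [X in idealM X I]idealMC (idealMC _ L) (idealMC I J); apply: idealM_subA.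
Qed.

Lemma idealMACA I J L M :
  idealM (idealM I J) (idealM L M) = idealM (idealM I L) (idealM J M).
Proof. by rewrite -!idealMA; congr idealM; rewrite !idealMA (idealMC J). Qed.

Lemma idealM_ideal F I J :
  is_subfield F -> is_ideal F I -> is_ideal F J -> is_ideal F (idealM I J).
Proof.
move=> sF iI iJ; split; [|exact: idealM0|by move=> x y; apply: idealMD|].
  apply: idealM_min => [|x y|x y Ix Jy]; [exact: ringint0|exact: ringintD|].
  by apply: ringintM; [|apply: (ideal_int iI)|apply: (ideal_int iJ)].
move=> a z Oa; move: z; apply: idealM_min => [|x y|x y Ix Jy].
- by rewrite mulr0; apply: idealM0.
- by rewrite mulrDr; apply: idealMD.
- by rewrite mulrA; apply: idealM_mem => //; apply: (ideal_mul iI).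
Qed.

Lemma idealM_nzideal F I J :
  is_subfield F -> is_nzideal F I -> is_nzideal F J -> is_nzideal F (idealM I J).
Proof.
move=> sF [iI [x Ix xN0]] [iJ [y Jy yN0]]; split; first exact: idealM_ideal.
by exists (x * y); [apply: idealM_mem | rewrite mulf_neq0].
Qed.

Lemma idealM1 F I : is_subfield F -> is_ideal F I -> idealM I (ringint F) = I.
Proof.
move=> sF iI; apply/seteqP; split.
  apply: idealM_min => [|x y|x y Ix Oy]; [exact: ideal0 iI|exact: idealD iI|].
  by rewrite mulrC; apply: (ideal_mul iI).
by move=> x Ix; rewrite -[x]mulr1; apply: idealM_mem => //; apply: ringint1.
Qed.

Lemma scale_mem (a x : algC) I : I x -> scale a I (a * x).
Proof. by move=> Ix; exists x. Qed.

Lemma scale_scale (a b : algC) I : scale a (scale b I) = scale (a * b) I.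
Proof.
apply/seteqP; split=> [_ [_ [x Ix <-] <-]|_ [x Ix <-]].
  by rewrite mulrA; apply: scale_mem.
by rewrite -mulrA; do 2!apply: scale_mem.
Qed.

Lemma scale1 I : scale 1 I = I.
Proof.
apply/seteqP; split=> [_ [x Ix <-]|x Ix]; first by rewrite mul1r.
by exists x; rewrite ?mul1r.
Qed.

Lemma scaleI (a : algC) I J : a != 0 -> scale a I = scale a J -> I = J.
Proof.
move=> aN0 /(congr1 (scale a^-1)); rewrite !scale_scale mulVf //.
by rewrite !scale1.
Qed.

Lemma scale_idealM (a : algC) I J : scale a (idealM I J) = idealM (scale a I) J.
Proof.
apply/seteqP; split=> [_ [z zIJ <-]|].
  move: z zIJ; apply: idealM_min => [|x y|x y Ix Jy].
  - by rewrite mulr0; apply: idealM0.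
  - by rewrite mulrDr; apply: idealMD.
  - by rewrite mulrA; apply: idealM_mem => //; apply: scale_mem.
apply: idealM_min => [|_ _ [x xIJ <-] [y yIJ <-]|_ y [x Ix <-] Jy].
- by exists 0; [apply: idealM0 | rewrite mulr0].
- by rewrite -mulrDr; apply: scale_mem; apply: idealMD.
- by rewrite -mulrA; apply: scale_mem; apply: idealM_mem.
Qed.

Lemma scale_idealMM (a b : algC) I J :
  idealM (scale a I) (scale b J) = scale (a * b) (idealM I J).
Proof.
by rewrite -scale_idealM idealMC -scale_idealM scale_scale (idealMC J).
Qed.

Lemma scale_ideal F I (a : algC) :
  is_subfield F -> ringint F a -> is_ideal F I -> is_ideal F (scale a I).
Proof.
move=> sF Oa iI; split.
- by move=> _ [x Ix <-]; apply: ringintM => //; apply: (ideal_int iI).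
- by exists 0; [apply: (ideal0 iI) | rewrite mulr0].
- by move=> _ _ [x Ix <-] [y Iy <-]; rewrite -mulrDr; apply: scale_mem; apply: (idealD iI).
- by move=> b _ Ob [x Ix <-]; rewrite mulrCA; apply: scale_mem; apply: (ideal_mul iI).
Qed.

Lemma scale_unit F (u : algC) : is_subfield F ->
  is_unit F u -> scale u (ringint F) = ringint F.
Proof.
move=> sF [Ou uN0 OuV]; apply/seteqP; split=> [_ [x Ox <-]|x Ox].
  exact: ringintM.
by exists (u^-1 * x); [apply: ringintM | rewrite mulVKf].
Qed.

Lemma scale_ringint_eq F (a b : algC) : is_subfield F ->
    F a -> F b -> a != 0 -> b != 0 ->
    scale a (ringint F) = scale b (ringint F) ->
  is_unit F (a / b).
Proof.
move=> sF Fa Fb aN0 bN0 ab.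
have O1 := ringint1 sF.
have : scale b (ringint F) (a * 1) by rewrite -ab; apply: scale_mem.
have : scale a (ringint F) (b * 1) by rewrite ab; apply: scale_mem.
rewrite !mulr1 => -[x Ox xE] [y Oy yE].
split.
- by rewrite -yE mulrAC mulfV // mul1r.
- by rewrite mulf_neq0 ?invr_eq0.
- by rewrite invf_div -xE mulrAC mulfV // mul1r.
Qed.

(** * Equivalence of ideals, extension of classes and the capitulation kernel *)

Definition ideal_equiv (F I J : set algC) : Prop :=
  exists a b, [/\ ringint F a, ringint F b, a != 0, b != 0 & scale a I = scale b J].

Lemma ideal_equiv_refl F I : is_subfield F -> ideal_equiv F I I.
Proof. by move=> sF; exists 1, 1; split; rewrite ?oner_eq0 //; apply: ringint1. Qed.

Lemma ideal_equiv_sym F I J : ideal_equiv F I J -> ideal_equiv F J I.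
Proof. by move=> [a [b [? ? ? ? ?]]]; exists b, a; split. Qed.

Lemma ideal_equiv_trans F I J L : is_subfield F ->
  ideal_equiv F I J -> ideal_equiv F J L -> ideal_equiv F I L.
Proof.
move=> sF [a [b [Oa Ob aN0 bN0 ab]]] [c [e [Oc Oe cN0 eN0 ce]]].
exists (c * a), (b * e); split; rewrite ?mulf_neq0 //; try exact: ringintM.
by rewrite -scale_scale ab scale_scale -(scale_scale b e) -ce scale_scale mulrC.
Qed.

Lemma ideal_equivM F I J I' J' : is_subfield F ->
  ideal_equiv F I J -> ideal_equiv F I' J' ->
  ideal_equiv F (idealM I I') (idealM J J').
Proof.
move=> sF [a [b [Oa Ob aN0 bN0 ab]]] [c [e [Oc Oe cN0 eN0 ce]]].
exists (a * c), (b * e); split; rewrite ?mulf_neq0 //; try exact: ringintM.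
by rewrite -!scale_idealMM ab ce.
Qed.

(** Classes contain only nonzero ideals; [is_nzideal F J] guarantees that [J] belongs to its own
    class. *)
Lemma ideal_classP F I J : is_subfield F -> is_nzideal F J ->
  (ideal_class F I = ideal_class F J) <-> ideal_equiv F I J.
Proof.
move=> sF nJ; split=> [eqIJ|eqIJ].
  have : ideal_class F J J by split=> //; apply: ideal_equiv_refl.
  by rewrite -eqIJ => -[].
apply/seteqP; split=> L [nL eqL]; split=> //.
  by apply: ideal_equiv_trans eqL => //; apply: ideal_equiv_sym.
exact: ideal_equiv_trans eqIJ eqL.
Qed.

Lemma classM_ideal_class F I J : is_subfield F -> is_nzideal F I -> is_nzideal F J ->
  classM F (ideal_class F I) (ideal_class F J) = ideal_class F (idealM I J).
Proof.
move=> sF nI nJ; apply/seteqP; split=> [L [I' [J' [[nI' II'] [nJ' JJ'] [nL L']]]]|L LIJ].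
  split=> //; apply: ideal_equiv_trans L' => //; exact: ideal_equivM.
by exists I, J; split=> //; split=> //; apply: ideal_equiv_refl.
Qed.

Lemma ideal_extM (F K : set algC) I J :
  is_subfield F -> is_subfield K -> F `<=` K ->
  ideal_ext K (idealM I J) = idealM (ideal_ext K I) (ideal_ext K J).
Proof.
move=> sF sK FK; rewrite /ideal_ext idealMACA.
by rewrite (idealM1 sK (ringint_ideal sK)).
Qed.

Lemma ideal_ext_scale (K : set algC) (a : algC) I :
  ideal_ext K (scale a I) = scale a (ideal_ext K I).
Proof. by rewrite /ideal_ext scale_idealM. Qed.

Lemma ideal_ext_ringint (F K : set algC) :
  is_subfield F -> is_subfield K -> F `<=` K ->
  ideal_ext K (ringint F) = ringint K.
Proof.
move=> sF sK FK; apply/seteqP; split.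
  apply: idealM_min => [|x y|x y Ox Oy]; [exact: ringint0|exact: ringintD|].
  by apply: ringintM => //; apply: (ringint_sub FK).
by move=> x Ox; rewrite -[x]mul1r; apply: idealM_mem => //; apply: ringint1.
Qed.

Lemma ideal_ext_sub (K I : set algC) : is_subfield K -> I `<=` ideal_ext K I.
Proof.
by move=> sK x Ix; rewrite -[x]mulr1; apply: idealM_mem => //; apply: ringint1.
Qed.

Lemma ideal_ext_nzideal (F K I : set algC) :
  is_subfield F -> is_subfield K -> F `<=` K ->
  is_nzideal F I -> is_nzideal K (ideal_ext K I).
Proof.
move=> sF sK FK [iI [x Ix xN0]]; split; last first.
  by exists x => //; apply: ideal_ext_sub.
split; [|exact: idealM0|by move=> y z; apply: idealMD|].
  apply: idealM_min => [|y z|y z Iy Oz]; [exact: ringint0|exact: ringintD|].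
  by apply: ringintM => //; apply: (ringint_sub FK); apply: (ideal_int iI).
move=> a z Oa; move: z; apply: idealM_min => [|y z|y z Iy Oz].
- by rewrite mulr0; apply: idealM0.
- by rewrite mulrDr; apply: idealMD.
- by rewrite mulrCA; apply: idealM_mem => //; apply: ringintM.
Qed.

Lemma capitulationP (F K I : set algC) :
  is_subfield F -> is_subfield K -> F `<=` K -> is_nzideal F I ->
  capitulation F K (ideal_class F I) <->
  ideal_equiv K (ideal_ext K I) (ringint K).
Proof.
move=> sF sK FK nI; have nO := ringint_nzideal sK.
have eqE : class_ext K (ideal_class F I) = ideal_class K (ideal_ext K I).
  apply/seteqP; split=> [L [J [nJ [a [b [Oa Ob aN0 bN0 ab]]]] [nL JL]]|L LI].
    split=> //; apply: ideal_equiv_trans JL => //.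
    exists a, b; split=> //; try exact: (ringint_sub FK).
    by rewrite -!ideal_ext_scale ab.
  by exists I => //; split=> //; apply: ideal_equiv_refl.
rewrite /capitulation /= eqE -ideal_classP //.
by split=> [[]|] //; split=> //; exists I.
Qed.

Lemma capitulation_subgroup (F K : set algC) :
  is_subfield F -> is_subfield K -> F `<=` K ->
  is_Cl_subgroup F (capitulation F K).
Proof.
move=> sF sK FK; have nO := ringint_nzideal sF; have nO' := ringint_nzideal sK.
have OM : idealM (ringint K) (ringint K) = ringint K.
  by rewrite (idealM1 sK) //; case: nO'.
split.
- by move=> C [].
- apply/capitulationP => //; rewrite ideal_ext_ringint //; exact: ideal_equiv_refl.
- move=> C D CC DD; case: (CC) (DD) => [[I nI CE] _] [[J nJ DE] _].
  move: CC DD; rewrite CE DE => /capitulationP CI /capitulationP DJ.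
  rewrite classM_ideal_class //; apply/capitulationP => //.
    exact: idealM_nzideal.
  by rewrite (ideal_extM _ _ sF) // -OM; apply: ideal_equivM => //; [apply: CI | apply: DJ].
- move=> C D CC [J nJ ->]; case: (CC) => [[I nI CE] _].
  move: CC; rewrite CE => /capitulationP -/(_ sF sK FK nI) CI.
  rewrite classM_ideal_class // => /ideal_classP -/(_ sF nO).
  move=> [a [b [Oa Ob aN0 bN0 ab]]]; apply/capitulationP => //.
  have nJ' := ideal_ext_nzideal sF sK FK nJ.
  (* Closure under inverses: writing I', J' for the extensions, J' = J' O_K is equivalent to J' I',
     which is the extension of I J and hence principal. *)
  rewrite -[X in ideal_equiv _ X _](idealM1 sK); last by case: nJ'.
  apply: (@ideal_equiv_trans _ _ (idealM (ideal_ext K J) (ideal_ext K I))) => //.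
    apply: ideal_equivM => //; [exact: ideal_equiv_refl | exact: ideal_equiv_sym].
  rewrite -(ideal_extM _ _ sF) // idealMC -(ideal_ext_ringint sF sK FK).
  exists a, b; split=> //; try exact: (ringint_sub FK).
  by rewrite -!ideal_ext_scale ab.
Qed.

(* For z in the right-hand side and w in I, (z w / a)^2 is integral, hence so is
   z w / a; thus z I <= I^2, and multiplying by I gives z a in a I. *)
Lemma ideal_sqr_rad F I (a : algC) : is_subfield F -> is_ideal F I ->
    a != 0 -> F a -> idealM I I = scale a (ringint F) ->
  I = [set z | ringint F z /\ scale a (ringint F) (z ^+ 2)].
Proof.
move=> sF iI aN0 Fa I2; apply/seteqP; split=> [z Iz|z [Oz [b Ob bE]]].
  by split; [apply: (ideal_int iI) | rewrite -I2 expr2; apply: idealM_mem].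
have zI w : I w -> scale a (ringint F) (z * w).
  move=> Iw; have Ow := ideal_int iI Iw.
  have [c Oc cE] : scale a (ringint F) (w ^+ 2).
    by rewrite -I2 expr2; apply: idealM_mem.
  exists (z * w / a); last by rewrite mulrC divfK.
  apply: ringint_sqr; first by case: Oz Ow => ? _ [? _]; subfield.
  have -> : (z * w / a) ^+ 2 = b * c by rewrite expr_div_n exprMn -bE -cE; field.
  by case: (ringintM sF Ob Oc).
have zaI : scale a I (z * a).
  suff: idealM I I `<=` [set t | scale a I (z * t)].
    by apply; rewrite I2; exists 1; rewrite ?mulr1 //; apply: ringint1.
  apply: idealM_min => /=.
  - by rewrite mulr0; exists 0; rewrite ?mulr0 //; apply: (ideal0 iI).
  - move=> x y [x' Ix' xE] [y' Iy' yE]; exists (x' + y'); first exact: (idealD iI).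
    by rewrite !mulrDr xE yE.
  - move=> x y /zI[t Ot tE] Iy; exists (t * y); first exact: (ideal_mul iI).
    by rewrite !mulrA tE.
case: zaI => z' Iz' zE; suff -> : z = z' by [].
by apply: (mulfI aN0); rewrite zE mulrC.
Qed.

(** * Ideals with principal square, handled through a generator of the square *)

Definition square_ideal (F I : set algC) (a : algC) : Prop :=
  [/\ is_ideal F I, ringint F a, a != 0 & idealM I I = scale a (ringint F)].

Lemma square_ideal_nz F I (a : algC) : is_subfield F ->
  square_ideal F I a -> is_nzideal F I.
Proof.
move=> sF [iI Oa aN0 I2]; split=> //; exists a => //.
rewrite (ideal_sqr_rad sF iI aN0 _ I2); last by case: Oa.
by split=> //; exists a => //; rewrite expr2.
Qed.

Lemma square_ideal_eq F I J (a : algC) : is_subfield F ->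
  square_ideal F I a -> square_ideal F J a -> I = J.
Proof.
move=> sF [iI [Fa _] aN0 I2] [iJ _ _ J2].
by rewrite (ideal_sqr_rad sF iI aN0 Fa I2) (ideal_sqr_rad sF iJ aN0 Fa J2).
Qed.

Lemma square_ideal_scale F I (a t : algC) : is_subfield F ->
  ringint F t -> t != 0 -> square_ideal F I a ->
  square_ideal F (scale t I) (t ^+ 2 * a).
Proof.
move=> sF Ot tN0 [iI Oa aN0 I2]; split.
- exact: scale_ideal.
- by apply: ringintM => //; rewrite expr2; apply: ringintM.
- by rewrite mulf_neq0 ?expf_neq0.
- by rewrite scale_idealMM I2 scale_scale expr2.
Qed.

Lemma square_ideal_unit F I (a u : algC) : is_subfield F ->
  is_unit F u -> square_ideal F I a -> square_ideal F I (a * u).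
Proof.
move=> sF uU; have [Ou uN0 _] := uU; move=> [iI Oa aN0 I2]; split=> //.
- exact: ringintM.
- by rewrite mulf_neq0.
- by rewrite I2 -scale_scale (scale_unit sF uU).
Qed.

Lemma square_idealM F I J (a b : algC) : is_subfield F ->
  square_ideal F I a -> square_ideal F J b -> square_ideal F (idealM I J) (a * b).
Proof.
move=> sF [iI Oa aN0 I2] [iJ Ob bN0 J2]; split.
- exact: idealM_ideal.
- exact: ringintM.
- by rewrite mulf_neq0.
- by rewrite idealMACA I2 J2 scale_idealMM (idealM1 sF (ringint_ideal sF)).
Qed.

Lemma square_ideal1 F : is_subfield F -> square_ideal F (ringint F) 1.
Proof.
move=> sF; split; [exact: ringint_ideal|exact: ringint1|exact: oner_neq0|].
by rewrite scale1 (idealM1 sF (ringint_ideal sF)).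
Qed.

(** The ideals s I and t J have squares generated by the same number up to a unit, so they are
    equal. *)
Lemma ideal_class_square F I J (a b u s t : algC) : is_subfield F ->
    square_ideal F I a -> square_ideal F J b -> is_unit F u ->
    ringint F s -> ringint F t -> s != 0 -> t != 0 ->
    a * u * s ^+ 2 = b * t ^+ 2 ->
  ideal_class F I = ideal_class F J.
Proof.
move=> sF aI bJ uU Os Ot sN0 tN0 abE; apply/ideal_classP => //.
  exact: square_ideal_nz bJ.
exists s, t; split=> //; apply: (square_ideal_eq (a := b * t ^+ 2) sF).
  rewrite -abE mulrC; apply: square_ideal_scale => //.
  exact: square_ideal_unit.
by rewrite mulrC; apply: square_ideal_scale.
Qed.

Lemma square_ideal_ext (F K I : set algC) (a : algC) :
    is_subfield F -> is_subfield K -> F `<=` K ->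
  square_ideal F I a -> square_ideal K (ideal_ext K I) a.
Proof.
move=> sF sK FK aI; have [iI Oa aN0 I2] := aI; split=> //.
- by have [] := ideal_ext_nzideal sF sK FK (square_ideal_nz sF aI).
- exact: (ringint_sub FK).
- by rewrite -(ideal_extM _ _ sF) // I2 ideal_ext_scale ideal_ext_ringint.
Qed.

Lemma square_ideal_principal F I (a u b : algC) : is_subfield F ->
    square_ideal F I a -> is_unit F u -> F b -> a * u = b ^+ 2 ->
  ideal_class F I = class1 F.
Proof.
move=> sF aI uU Fb abE; have [iI Oa aN0 _] := aI; have [Ou uN0 _] := uU.
have bN0 : b != 0 by rewrite -sqrf_eq0 -abE mulf_neq0.
apply: (ideal_class_square (s := 1) sF aI (square_ideal1 sF) uU (t := b)) => //.
- exact: ringint1.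
- by apply: ringint_sqr; rewrite // -abE; case: (ringintM sF Oa Ou).
- exact: oner_neq0.
- by rewrite abE expr1n mulr1 mul1r.
Qed.

(** The extension of I has square (a) = (b^2), hence is generated by b. This puts the listed
    generators into the kernel. *)
Lemma capitulation_square (F K I : set algC) (a u b : algC) :
    is_subfield F -> is_subfield K -> F `<=` K ->
    square_ideal F I a -> is_unit K u -> K b -> a * u = b ^+ 2 ->
  capitulation F K (ideal_class F I).
Proof.
move=> sF sK FK aI uU Kb abE; apply/capitulationP => //.
  exact: square_ideal_nz aI.
apply/ideal_classP => //; first exact: ringint_nzideal.
exact: (square_ideal_principal sK (square_ideal_ext sF sK FK aI) uU Kb).
Qed.

Lemma Cl_genP (F : set algC) S G :
  is_Cl_subgroup F G -> S `<=` G -> Cl_gen F S `<=` G.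
Proof. by move=> sG SG C; apply; split. Qed.

(* I^2 is generated by the norm of a generator of I O_K: the cross terms of the
   norm of a sum in I O_K are traces, hence lie in O_F. *)
Lemma capitulation_norm (F K I : set algC) (sg : {rmorphism algC -> algC}) :
    is_subfield F -> is_subfield K -> F `<=` K ->
    (forall z, F z -> sg z = z) -> (forall z, K z -> K (sg z)) ->
    (forall z, K z -> sg (sg z) = z) -> (forall z, K z -> sg z = z -> F z) ->
    is_nzideal F I -> capitulation F K (ideal_class F I) ->
  exists alpha, [/\ K alpha, alpha != 0, is_unit K (alpha / sg alpha) &
                    square_ideal F I (alpha * sg alpha)].
Proof.
move=> sF sK FK fixF KK sgK fixK nI /capitulationP -/(_ sF sK FK nI).
have iI := nI.1; move=> [c [b [Oc Ob cN0 bN0 cb]]]; pose al := b / c.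
have Kc : K c by case: Oc. have Kb : K b by case: Ob.
have Kal : K al by rewrite /al; subfield.
have alN0 : al != 0 by rewrite mulf_neq0 ?invr_eq0.
have extE : ideal_ext K I = scale al (ringint K).
  by apply: (scaleI cN0); rewrite cb scale_scale mulrC divfK.
have OO z : ringint K z -> ringint K (sg z).
  by move=> [Kz Az]; split; [apply: KK | rewrite Aint_aut].
have OF z : ringint K z -> sg z = z -> ringint F z.
  by move=> [Kz Az] fz; split=> //; apply: fixK.
have sgext z : ideal_ext K I z -> ideal_ext K I (sg z).
  move: z; apply: idealM_min => [|x y|x y Ix Oy].
  - by rewrite rmorph0; apply: idealM0.
  - by rewrite rmorphD; apply: idealMD.
  - rewrite rmorphM fixF; last by case: (ideal_int iI Ix).
    by apply: idealM_mem => //; apply: OO.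
have sgal : sg al != 0 by rewrite fmorph_eq0.
(* The extended ideal is stable under [sg], so [al] and its conjugate both generate it; their
   quotient is therefore a unit. *)
have eqsg : scale al (ringint K) = scale (sg al) (ringint K).
  have ext_al : ideal_ext K I al.
    by rewrite extE; exists 1; rewrite ?mulr1 //; apply: ringint1.
  have [u Ou uE] : scale al (ringint K) (sg al) by rewrite -extE; apply: sgext.
  have alE : al = sg al * sg u.
    by rewrite -rmorphM uE sgK.
  apply/seteqP; split=> _ [x Ox <-].
    by exists (sg u * x); [apply: ringintM => //; apply: OO | rewrite mulrA -alE].
  by exists (u * x); [apply: ringintM | rewrite mulrA uE].
exists al; split=> //; first by apply: (scale_ringint_eq sK) => //; apply: KK.
have Kn : K (al * sg al) by have := KK _ Kal; move=> ?; subfield.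
have Fn : F (al * sg al).
  by apply: fixK => //; rewrite rmorphM sgK // mulrC.
have tr_in s w : ideal_ext K I s -> ringint K w -> I (s * w + sg (s * w)).
  move=> Is Ow; move: s Is; apply: idealM_min => [|x y Ix Iy|x y Ix Oy].
  - by rewrite mul0r rmorph0 addr0; apply: (ideal0 iI).
  - have -> : (x + y) * w + sg ((x + y) * w) =
              (x * w + sg (x * w)) + (y * w + sg (y * w)).
      by rewrite mulrDl rmorphD; ring.
    exact: (idealD iI).
  - have Oyw : ringint K (y * w) by apply: ringintM.
    have -> : x * y * w + sg (x * y * w) = (y * w + sg (y * w)) * x.
      rewrite -mulrA (rmorphM _ x) (fixF x); last by case: (ideal_int iI Ix).
      by ring.
    apply: (ideal_mul iI) => //; apply: OF; first by apply: ringintD => //; apply: OO.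
    by rewrite rmorphD sgK 1?addrC; last case: Oyw.
have norm_in : idealM I I (al * sg al).
  have : ideal_ext K I al by rewrite extE; exists 1; rewrite ?mulr1 //; apply: ringint1.
  (* Membership of [s] itself is carried through the induction because [tr_in] needs it for the
     cross term. *)
  suff: ideal_ext K I `<=` [set s | ideal_ext K I s /\ idealM I I (s * sg s)].
    by move=> sub /sub[].
  move=> _ [n [x [y [Ix Oy ->]]]].
  elim: n x y Ix Oy => [|n IHn] x y Ix Oy.
    by rewrite big_ord0 /= mul0r; split; apply: idealM0.
  rewrite big_ord_recl; set s := \sum_(i < n) _.
  have [sI sN] : ideal_ext K I s /\ idealM I I (s * sg s) by apply: IHn.
  split; first by apply: idealMD => //; apply: idealM_mem.
  set x0 := x ord0; set y0 := y ord0.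
  have Fx0 : sg x0 = x0 by apply: fixF; case: (ideal_int iI (Ix ord0)).
  have Oy0 : ringint K y0 by apply: Oy.
  have Ky0 : K y0 by case: Oy0.
  have -> : (x0 * y0 + s) * sg (x0 * y0 + s) =
    x0 * ((y0 * sg y0) * x0) + (x0 * (s * sg y0 + sg (s * sg y0)) + s * sg s).
    by rewrite rmorphD !rmorphM Fx0 (sgK y0) //; ring.
  apply: idealMD; last apply: idealMD => //.
    apply: idealM_mem; first exact: Ix.
    apply: (ideal_mul iI); last exact: Ix.
    apply: OF; first by apply: ringintM => //; apply: OO.
    by rewrite rmorphM sgK // mulrC.
  by apply: idealM_mem; [apply: Ix | apply: tr_in => //; apply: OO].
have nN0 : al * sg al != 0 by rewrite mulf_neq0.
(* By [eqsg], x is a multiple of [al] and y a multiple of [sg al], so x y is the norm times an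
   integer of K; that integer lies in F. *)
have I2 : idealM I I `<=` scale (al * sg al) (ringint F).
  apply: idealM_min => [|_ _ [x Ox <-] [y Oy <-]|x y Ix Iy].
  - by exists 0; rewrite ?mulr0 //; apply: ringint0.
  - by rewrite -mulrDr; apply: scale_mem; apply: ringintD.
  - exists (x * y / (al * sg al)); last by rewrite mulrC divfK.
    have [x' Ox' xE] : scale al (ringint K) x by rewrite -extE; apply: ideal_ext_sub.
    have [y' Oy' yE] : scale (sg al) (ringint K) y.
      by rewrite -eqsg -extE; apply: ideal_ext_sub.
    have [Fx _] := ideal_int iI Ix; have [Fy _] := ideal_int iI Iy.
    split; first by subfield.
    have -> : x * y / (al * sg al) = x' * y'.
      by rewrite -xE -yE; field; rewrite ?alN0 ?sgal.
    by case: (ringintM sK Ox' Oy').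
split=> //; last first.
  apply/seteqP; split=> // _ [x Ox <-]; rewrite mulrC.
  by apply: (ideal_mul (idealM_ideal sF iI iI)).
exact: (ideal_int (idealM_ideal sF iI iI)) norm_in.
Qed.

(** * Squarefree integers *)

(** Let G = gcd(a, c). Then a divides G^2 because it divides both a G and c G = gcd(c a, a b);
    conversely G^2 divides c^2 = a b and is coprime to b. *)
Lemma coprime_mul_sqr (a b c : nat) :
  coprime a b -> (a * b = c ^ 2)%N -> exists s, a = (s ^ 2)%N.
Proof.
move=> co_ab abE; exists (gcdn a c).
apply/eqP; rewrite eqn_dvd; apply/andP; split.
  have -> : (gcdn a c ^ 2 = gcdn (a * gcdn a c) (c * gcdn a c))%N.
    by rewrite -muln_gcdl.
  rewrite dvdn_gcd dvdn_mulr //=.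
  have -> : (c * gcdn a c = gcdn (c * a) (c * c))%N by rewrite -muln_gcdr.
  by rewrite dvdn_gcd dvdn_mull // mulnn -abE dvdn_mulr.
have co_gb : coprime (gcdn a c ^ 2) b.
  by rewrite coprimeXl // (coprime_dvdl (dvdn_gcdl a c)).
by rewrite -(Gauss_dvdl _ co_gb) abE dvdn_exp2r // dvdn_gcdr.
Qed.

(** G is the gcd of m and n: the cofactors are coprime with square product, so m / G is a square up
    to sign. Only divisibilities by G are recorded; they later bound G through linear combinations
    of m, n and b. *)
Lemma mul_sqr_gcd (m n b : int) : m * n = b ^+ 2 -> m != 0 ->
  exists (G : nat) (s : int) (e : bool),
    [/\ m = (-1) ^+ e * (G%:Z * s ^+ 2), (G %| `|m|)%N, (G %| `|n|)%N &
        (G %| `|b|)%N].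
Proof.
move=> mnE mN0; pose M := `|m|%N; pose N := `|n|%N; pose B := `|b|%N.
have MNE : (M * N = B ^ 2)%N by rewrite /M /N /B -abszM mnE abszX.
have M_gt0 : (0 < M)%N by rewrite absz_gt0.
pose G := gcdn M N.
have G_gt0 : (0 < G)%N by rewrite gcdn_gt0 M_gt0.
have [M' ME] : exists M', M = (M' * G)%N by apply/dvdnP; apply: dvdn_gcdl.
have [N' NE] : exists N', N = (N' * G)%N by apply/dvdnP; apply: dvdn_gcdr.
have co : coprime M' N'.
  rewrite /coprime -(eqn_pmul2r G_gt0) mul1n muln_gcdl -ME -NE //.
have GB : (G %| B)%N.
  by rewrite -(@dvdn_pexp2r _ _ 2) // -MNE ME NE; apply/dvdnP; exists (M' * N')%N; ring.
have [B' BE] : exists B', B = (B' * G)%N by apply/dvdnP.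
have [|s sE] := @coprime_mul_sqr M' N' B' co.
  apply/eqP; rewrite -(@eqn_pmul2r (G ^ 2)) ?expn_gt0 ?G_gt0 //; apply/eqP.
  by rewrite -expnMn -BE -MNE ME NE; ring.
exists G, s%:Z, (m < 0); split; rewrite ?dvdn_gcdl ?dvdn_gcdr //.
rewrite {1}(intEsign m); congr (_ * _); rewrite -/M ME sE mulnC PoszM.
by rewrite -rmorphXn.
Qed.

Definition squarefree (m : nat) := forall l, prime l -> ~~ (l ^ 2 %| m)%N.

Lemma squarefree_prod (s : seq nat) :
  all prime s -> uniq s -> squarefree (\prod_(p <- s) p)%N.
Proof.
move=> prs uniqs l prl.
have [prod_gt0 lognE] : (0 < \prod_(p <- s) p)%N /\
    logn l (\prod_(p <- s) p)%N = count_mem l s.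
  elim: s prs {uniqs} => [_|p s IHs /= /andP[prp /IHs[s_gt0 sE]]].
    by rewrite big_nil logn1.
  have p_gt0 := prime_gt0 prp; rewrite big_cons muln_gt0 p_gt0 s_gt0; split=> //.
  by rewrite (lognM _ p_gt0 s_gt0) sE logn_prime // eq_sym.
rewrite pfactor_dvdn // lognE count_uniq_mem //.
by case: (l \in s).
Qed.

(** The square of the denominator of t is coprime to the numerator, so it must divide m. *)
Lemma Crat_sqr_squarefree (m : nat) (t : algC) : squarefree m ->
  t \in Crat -> t ^+ 2 * m%:R \in Num.int -> t \in Num.int.
Proof.
move=> sqm /CratP[a ->].
rewrite -(ratr_nat algC) -rmorphXn -rmorphM /= !Cint_rat => /intrP[c cE].
have dN0 : (denq a)%:~R != 0 :> rat by rewrite intr_eq0 denq_neq0.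
have eqZ : numq a ^+ 2 * m%:Z = c * denq a ^+ 2.
  apply: (@intr_inj rat); rewrite !intrM -cE.
  have aE := divq_num_den a; move: dN0 aE; set d := (denq a)%:~R => dN0 aE.
  by rewrite -[X in X ^+ 2 * m%:R]aE; field.
have dvd2 : (`|denq a| ^ 2 %| m)%N.
  have co : coprime (`|denq a| ^ 2) (`|numq a| ^ 2).
    by rewrite coprimeXl // coprimeXr // coprime_sym coprime_num_den.
  rewrite -(Gauss_dvdr _ co) -!abszX -[m]absz_nat -abszM eqZ abszM.
  by rewrite dvdn_mull.
have den1 : `|denq a|%N = 1%N.
  apply/eqP; rewrite eqn_leq absz_gt0 denq_neq0 andbT leqNgt; apply/negP => d_gt1.
  have := sqm _ (pdiv_prime d_gt1); rewrite (dvdn_trans _ dvd2) //.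
  by rewrite dvdn_exp2r // pdiv_dvd.
have d1 : denq a = 1 by rewrite -absz_denq den1.
by rewrite -[a]divq_num_den d1 divr1 rpred_int.
Qed.

Lemma Crat_sqr_neq (n : nat) (z : algC) : squarefree n -> (1 < n)%N ->
  z \in Crat -> z ^+ 2 <> n%:R.
Proof.
move=> sqn n_gt1 zQ zE.
have /intrP[c cE] : z \in Num.int.
  by apply: Cint_rat_Aint => //; apply: Aint_sqr; rewrite zE (Aint_int n).
have nE : n = (`|c| ^ 2)%N.
  have c2 : c ^+ 2 = n%:Z by apply: (@intr_inj algC); rewrite rmorphXn /= -cE zE.
  by rewrite -abszX c2.
have c_gt1 : (1 < `|c|)%N by rewrite -(@ltn_sqr 1) -nE.
have := sqn _ (pdiv_prime c_gt1).
by rewrite nE dvdn_exp2r // pdiv_dvd.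
Qed.

(** * Quadratic fields *)

Definition Gauss : set algC := quadext Qfield 'i.

Lemma Gauss_subfield : is_subfield Gauss.
Proof.
apply: quadext_subfield; first exact: Qfield_subfield.
by rewrite sqrCi /Qfield /= rpredN rpred1.
Qed.

(** Comparing with the complex conjugate gives a b = 0: z is purely imaginary, with square at most
    0, or rational. *)
Lemma Gauss_sqr_neq (n : nat) (z : algC) : squarefree n -> (1 < n)%N ->
  Gauss z -> z ^+ 2 <> n%:R.
Proof.
move=> sqn n_gt1 [a [b [aQ bQ ->]]] zE.
have i2 := sqrCi algC.
have ab0 : a * b = 0.
  have zE' : (a - b * 'i) ^+ 2 = n%:R.
    rewrite -[RHS]conjC_nat -zE rmorphXn rmorphD rmorphM /= conjCi mulrN.
    by rewrite !conj_Crat.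
  have : 4 * 'i * (a * b) = 0 :> algC.
    by transitivity ((a + b * 'i) ^+ 2 - (a - b * 'i) ^+ 2); [ring | rewrite zE zE' subrr].
  by move/eqP; rewrite mulf_eq0 mulf_eq0 pnatr_eq0 (negbTE (neq0Ci _)) => /eqP.
move/eqP: ab0; rewrite mulf_eq0 => /orP[]/eqP E0; move: zE; rewrite E0.
  rewrite add0r exprMn i2 mulrN1 => zE.
  have : 0 <= b ^+ 2 by rewrite real_exprn_even_ge0 // Creal_Crat.
  by rewrite -oppr_le0 zE lern0 => /eqP n0; rewrite n0 in n_gt1.
by rewrite mul0r addr0; apply: Crat_sqr_neq.
Qed.

(** Squaring sqrt n = A + B sqrt m would put sqrt m (if A B is nonzero), sqrt (m n) (if A = 0) or
    sqrt n (if B = 0) into Q(i). *)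
Lemma sqrtC_notin_Gauss_quadext (m n : nat) :
  squarefree m -> squarefree n -> squarefree (m * n) ->
  (1 < m)%N -> (1 < n)%N -> ~ quadext Gauss (sqrtC m%:R) (sqrtC n%:R).
Proof.
move=> sfm sfn sfmn m_gt1 n_gt1 [A [B [GA GB nE]]].
have sG := Gauss_subfield.
set s := sqrtC m%:R in nE; have s2 : s ^+ 2 = m%:R by rewrite sqrtCK.
have n2 : (A + B * s) ^+ 2 = n%:R by rewrite -nE sqrtCK.
have [AB0|ABN0] := eqVneq (2 * A * B) 0; last first.
  suff Gs : Gauss s by apply: (Gauss_sqr_neq sfm m_gt1 Gs).
  have -> : s = (n%:R - A ^+ 2 - B ^+ 2 * m%:R) / (2 * A * B).
    rewrite -n2 -s2; move: ABN0; rewrite !mulf_eq0 !negb_or => /andP[/andP[? hA] hB].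
    by field; rewrite ?hA ?hB.
  by subfield.
move/eqP: AB0; rewrite !mulf_eq0 pnatr_eq0 /= => /orP[]/eqP E0.
  apply: (@Gauss_sqr_neq (m * n) (B * m%:R) sfmn _ _).
  - exact: ltn_mul m_gt1 n_gt1.
  - by subfield.
  - by rewrite natrM -n2 E0 add0r exprMn exprMn s2; ring.
apply: (Gauss_sqr_neq sfn n_gt1 GA).
by rewrite -n2 E0 mul0r addr0.
Qed.

(** Used in both orders for q and p1 p2, this yields two generators of the Galois group of Q(sqrt q,
    sqrt P, i) over Q(i). *)
Lemma exists_aut_sqrtC (m n : nat) :
  squarefree m -> squarefree n -> squarefree (m * n) ->
  (1 < m)%N -> (1 < n)%N ->
  exists nu : {rmorphism algC -> algC},
    [/\ nu 'i = 'i, nu (sqrtC m%:R) = sqrtC m%:R & nu (sqrtC n%:R) = - sqrtC n%:R].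
Proof.
move=> sfm sfn sfmn m_gt1 n_gt1; have sG := Gauss_subfield.
have sF : is_subfield (quadext Gauss (sqrtC m%:R)).
  by apply: quadext_subfield => //; rewrite sqrtCK; subfield.
have [|||nu [nus nuc]] := @exists_aut_flip _ [:: 'i; sqrtC m%:R] (sqrtC n%:R) sF.
- move=> x; rewrite !inE => /orP[]/eqP->; last exact: quadext_gen.
  by apply: quadext_base => //; apply: quadext_gen; apply: Qfield_subfield.
- by rewrite sqrtCK rpred_nat.
- exact: sqrtC_notin_Gauss_quadext.
by exists nu; split=> //; apply: nus; rewrite !inE eqxx ?orbT.
Qed.

Lemma two_eq_i3_sqr : 2 = 'i ^+ 3 * (1 + 'i) ^+ 2 :> algC.
Proof.
have i2 := sqrCi algC.
transitivity ('i * ('i ^+ 2 * (1 + 2 * 'i + 'i ^+ 2)) : algC); last by ring.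
rewrite i2; transitivity (- 2 * 'i ^+ 2 : algC); last by ring.
by rewrite i2; ring.
Qed.

Lemma Ci1_neq0 : 1 + 'i != 0 :> algC.
Proof.
apply/eqP => i1; have := two_eq_i3_sqr; rewrite i1 expr0n mulr0 => /eqP.
by rewrite pnatr_eq0.
Qed.

(** * Congruences modulo 4 and units of real quadratic fields *)

Lemma int_parity (x : int) : exists (y : int) (b : bool), x = 2 * y + b%:Z.
Proof.
exists (x %/ 2)%Z, (x %% 2 != 0)%Z; rewrite {1}(divz_eq x 2) mulrC; congr (_ + _).
have := ltz_pmod x (isT : 0 < 2 :> int); have := modz_ge0 x (isT : 2 != 0 :> int).
by move: (x %% 2)%Z => [[|[|]]|].
Qed.

(** Modulo 4 the left side is X^2 + Y^2, which vanishes only when both are even. *)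
Lemma even_of_sqr_sub (X Y m c : int) :
  X * X - (4 * m + 3) * (Y * Y) = 4 * c -> exists x y : int, X = 2 * x /\ Y = 2 * y.
Proof.
have [x [[] ->]] := int_parity X; have [y [[] ->]] := int_parity Y => E.
- suff : 4 * (x * x + x - (4 * m + 3) * (y * y + y) - m - c) = 2 by lia.
  by move: E; lia.
- suff : 4 * (c + (4 * m + 3) * (y * y) - x * x - x) = 1 by lia.
  by move: E; lia.
- suff : 4 * (x * x - (4 * m + 3) * (y * y + y) - m - c) = 3 by lia.
  by move: E; lia.
- by exists x, y; rewrite !addr0.
Qed.

(** A sum of two squares is never 3 modulo 4. *)
Lemma sqr_sub_neqN1 (X Y m : int) : X * X - (4 * m + 3) * (Y * Y) <> -1.
Proof.
have [x [[] ->]] := int_parity X; have [y [[] ->]] := int_parity Y => E.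
- suff : 4 * (x * x + x - (4 * m + 3) * (y * y + y) - m) = 1 by lia.
  by move: E; lia.
- suff : 4 * (x * x + x - (4 * m + 3) * (y * y)) = -2 by lia.
  by move: E; lia.
- suff : 4 * (x * x - (4 * m + 3) * (y * y + y) - m) = 2 by lia.
  by move: E; lia.
- suff : 4 * (x * x - (4 * m + 3) * (y * y)) = -1 by lia.
  by move: E; lia.
Qed.

(** 2a is the trace, and 2b sqrt m the difference of conjugates, so (2b)^2 m is an integer and
    squarefreeness clears the denominator of 2b. The doubling is there because half-integers occur
    when m is 1 modulo 4. *)
Lemma quad_coord_int (m : nat) (nu : {rmorphism algC -> algC}) (a b : algC) :
  squarefree m -> nu (sqrtC m%:R) = - sqrtC m%:R ->
  a \in Crat -> b \in Crat -> a + b * sqrtC m%:R \in Aint ->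
  exists X Y : int, 2 * a = X%:~R /\ 2 * b = Y%:~R.
Proof.
move=> sfm nus aQ bQ uA; set s := sqrtC m%:R in nus uA.
have nuA : a - b * s \in Aint.
  by rewrite -(Aint_aut nu) rmorphB rmorphM nus !aut_Crat // mulrN opprK.
have /intrP[X XE] : 2 * a \in Num.int.
  apply: Cint_rat_Aint; first by rewrite rpredM ?rpred_nat.
  have -> : 2 * a = (a + b * s) + (a - b * s) by ring.
  by rewrite rpredD.
have /intrP[Y YE] : 2 * b \in Num.int.
  apply: (Crat_sqr_squarefree sfm); first by rewrite rpredM ?rpred_nat.
  apply: Cint_rat_Aint; first by rewrite rpredM ?rpred_nat ?rpredX ?rpredM ?rpred_nat.
  have -> : (2 * b) ^+ 2 * m%:R = ((a + b * s) - (a - b * s)) ^+ 2.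
    by rewrite -[m%:R]sqrtCK -/s; ring.
  by rewrite rpredX // rpredB.
by exists X, Y.
Qed.

Lemma quad_unit_norm (m : nat) (nu : {rmorphism algC -> algC}) (a b : algC) :
  nu (sqrtC m%:R) = - sqrtC m%:R -> a \in Crat -> b \in Crat ->
  a + b * sqrtC m%:R \in Aint -> (a + b * sqrtC m%:R)^-1 \in Aint ->
  a + b * sqrtC m%:R != 0 ->
  a ^+ 2 - m%:R * b ^+ 2 = 1 \/ a ^+ 2 - m%:R * b ^+ 2 = -1.
Proof.
move=> nus aQ bQ uA uVA uN0; set s := sqrtC m%:R in nus uA uVA uN0.
set u := a + b * s in uA uVA uN0.
have nuE : nu u = a - b * s by rewrite rmorphD rmorphM nus !aut_Crat // mulrN.
have NE : a ^+ 2 - m%:R * b ^+ 2 = u * nu u.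
  by rewrite nuE -[m%:R]sqrtCK -/s /u; ring.
have NQ : u * nu u \in Crat.
  by rewrite -NE rpredB ?rpredM ?rpredX ?rpred_nat.
have /intrP[c cE] : u * nu u \in Num.int.
  by apply: Cint_rat_Aint => //; rewrite rpredM ?Aint_aut.
have /intrP[e eE] : (u * nu u)^-1 \in Num.int.
  apply: Cint_rat_Aint; first by rewrite rpredV.
  by rewrite invfM -fmorphV rpredM ?Aint_aut.
have ce1 : c * e = 1.
  apply: (@intr_inj algC); rewrite intrM -cE -eE mulfV //.
  by rewrite mulf_neq0 ?fmorph_eq0.
rewrite NE cE.
have : c \is a GRing.unit by apply/unitrP; exists e; rewrite ce1 mulrC ce1.
rewrite qualifE /= => /orP[]/eqP->; [by left | by right; rewrite mulrN1z].
Qed.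

(** As q is 3 modulo 4, u = x + y sqrt q with integers x, y and norm 1. Then 2 (x + 1) u = (x + 1 +
    y sqrt q)^2, while (x + 1)(x - 1) = q y^2 makes x + 1, up to sign and a possible factor q, a
    square times a divisor of 2; and q is a square in the field. *)
Lemma quad_unit_square (q : nat) (nu : {rmorphism algC -> algC}) (u : algC) :
  prime q -> (q %% 4 = 3)%N -> nu (sqrtC q%:R) = - sqrtC q%:R ->
  quadext Qfield (sqrtC q%:R) u -> u != 0 -> u \in Aint -> u^-1 \in Aint ->
  exists (e j : bool) (t : algC), [/\ quadext Qfield (sqrtC q%:R) t, t != 0 &
    u = (-1) ^+ e * 2 ^+ j * t ^+ 2].
Proof.
move=> pq qmod nus [a [b [aQ bQ uE]]] uN0 uA uVA.
rewrite uE in uN0 uA uVA *.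
have sfq : squarefree q.
  by have := @squarefree_prod [:: q]; rewrite big_seq1 /= pq; apply.
have sQ := Qfield_subfield.
set s := sqrtC q%:R in nus uN0 uA uVA *.
have s2 : s ^+ 2 = q%:R by rewrite sqrtCK.
have sN0 : s != 0 by rewrite sqrtC_eq0 pnatr_eq0 -lt0n prime_gt0.
have sE : is_subfield (quadext Qfield s).
  by apply: quadext_subfield => //; rewrite s2; subfield.
have Es : quadext Qfield s s by apply: quadext_gen.
have [X [Y [XE YE]]] := quad_coord_int sfq nus aQ bQ uA.
have [m mE] : exists m : int, q%:Z = 4 * m + 3.
  by exists (q %/ 4)%:Z; rewrite {1}(divn_eq q 4) qmod; lia.
have [c [cE normE]] : exists c : int, (c = 1 \/ c = -1) /\
    a ^+ 2 - q%:R * b ^+ 2 = c%:~R.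
  have [->|->] := quad_unit_norm nus aQ bQ uA uVA uN0.
    by exists 1; split=> //; left.
  by exists (-1); split; [right | rewrite mulrN1z].
have eqXY : X * X - (4 * m + 3) * (Y * Y) = 4 * c.
  rewrite -mE; apply: (@intr_inj algC); rewrite rmorphB /= !intrM -XE -YE -normE.
  by rewrite -[(q%:Z)%:~R]/(q%:R); ring.
have [x [y [XE' YE']]] := even_of_sqr_sub eqXY.
have n2 : 2 != 0 :> algC by rewrite pnatr_eq0.
have aE : a = x%:~R.
  by apply: (mulfI n2); rewrite XE XE' intrM.
have bE : b = y%:~R.
  by apply: (mulfI n2); rewrite YE YE' intrM.
have xyc : x * x - (4 * m + 3) * (y * y) = c by rewrite XE' YE' in eqXY; nia.
have c1 : c = 1 by case: cE => // cN; rewrite cN in xyc; case: (sqr_sub_neqN1 xyc).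
have xy1 : x * x - q%:Z * (y * y) = 1 by rewrite mE xyc c1.
(* For x = -1 the identity [key] degenerates, but then u = -1. *)
have [xN1|xN1] := eqVneq (x + 1) 0.
  have y0 : y = 0.
    have q_gt0 := prime_gt0 pq.
    have : q%:Z * (y * y) = 0 by nia.
    by move/eqP; rewrite !mulf_eq0 orbb => /orP[]/eqP; lia.
  exists true, false, 1; split; [by subfield | exact: oner_neq0 |].
  rewrite expr0 expr1 expr1n !mulr1 aE bE y0 mul0r addr0.
  have -> : x = -1 by lia.
  by rewrite mulrN1z.
have x1N0 : x%:~R + 1 != 0 :> algC by rewrite -(intrD algC x 1) intr_eq0.
have key : 2 * (x%:~R + 1) * (a + b * s) = (x%:~R + 1 + y%:~R * s) ^+ 2.
  rewrite aE bE; have : (x * x - q%:Z * (y * y))%:~R = 1 :> algC by rewrite xy1.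
  rewrite rmorphB /= !intrM -[(q%:Z)%:~R]/(q%:R) -s2 => E1.
  have -> : (x%:~R + 1 + y%:~R * s) ^+ 2 = 2 * (x%:~R + 1) * (x%:~R + y%:~R * s) +
    (1 - (x%:~R * x%:~R - s ^+ 2 * (y%:~R * y%:~R))) by ring.
  by rewrite E1 subrr addr0.
have prod_eq : (x + 1) * (x - 1) = q%:Z * (y * y) by nia.
have [r [G [z [e [rG GE x1E]]]]] : exists (r : bool) (G : nat) (z : int) (e : bool),
  [/\ (G %| 2)%N, (0 < G)%N &
    x + 1 = (-1) ^+ e * (G%:Z * z ^+ 2) * q%:Z ^+ r].
  (* The difference of x + 1 and x - 1 is 2. *)
  have Gdvd G : (G %| `|(x + 1)%R|)%N -> (G %| `|(x - 1)%R|)%N -> (G %| 2)%N.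
    move=> G1 G2; have : (G%:Z %| (x + 1) - (x - 1))%Z by apply: rpredB.
    by have -> : x + 1 - (x - 1) = 2 by lia.
  have qdvd : (q %| `|(x + 1)%R| * `|(x - 1)%R|)%N.
    by rewrite -abszM prod_eq abszM dvdn_mulr.
  have qN0 : q%:Z != 0 by rewrite -lt0n prime_gt0.
  move: qdvd; rewrite Euclid_dvdM // => /orP[] qd.
    have [x' xE'] : exists x', x + 1 = x' * q%:Z by apply/dvdzP.
    have x'N0 : x' != 0 by move: xN1; rewrite xE' mulf_eq0 negb_or => /andP[].
    have [|G [z [e [x'E G1 G2 _]]]] := @mul_sqr_gcd x' (x - 1) y _ x'N0.
      by apply: (mulfI qN0); rewrite mulrA (mulrC q%:Z) -xE' prod_eq expr2.
    exists true, G, z, e; split=> //.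
    - by apply: Gdvd => //; rewrite xE' abszM dvdn_mulr.
    - by rewrite lt0n; apply: contraNneq x'N0 => G0; rewrite x'E G0 mul0r mulr0.
    - by rewrite xE' x'E expr1.
  have [x' xE'] : exists x', x - 1 = x' * q%:Z by apply/dvdzP.
  have [|G [z [e [x'E G1 G2 _]]]] := @mul_sqr_gcd (x + 1) x' y _ xN1.
    by apply: (mulIf qN0); rewrite -mulrA -xE' prod_eq expr2 mulrC.
  exists false, G, z, e; split=> //.
  - by apply: Gdvd => //; rewrite xE' abszM dvdn_mulr.
  - by rewrite lt0n; apply: contraNneq xN1 => G0; rewrite x'E G0 mul0r mulr0.
  - by rewrite expr0 mulr1.
have zN0 : z%:~R != 0 :> algC.
  rewrite intr_eq0; apply: contraNneq xN1 => z0.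
  by rewrite x1E z0 expr0n /= !mulr0 mul0r.
have x1C : x%:~R + 1 = (-1) ^+ e * (G%:R * z%:~R ^+ 2) * (s ^+ r) ^+ 2 :> algC.
  rewrite -(intrD algC x 1) x1E !intrM !rmorphXn /= intrN exprAC s2.
  by [].
have tE : quadext Qfield s ((x%:~R + 1 + y%:~R * s) / (2 * z%:~R * s ^+ r)).
  by subfield.
have G12 : G = 1%N \/ G = 2%N.
  by move: rG GE; case: G {x1E x1C} => [|[|[|G]]] //; auto; move/dvdn_leq; lia.
have tN0 : (x%:~R + 1 + y%:~R * s) / (2 * z%:~R * s ^+ r) != 0.
  rewrite !(mulf_neq0, invr_neq0, expf_neq0) //.
  by rewrite -sqrf_eq0 -key !mulf_neq0.
(* Up to sign and squares u is 2 G, so the factor 2 survives exactly when G = 1. *)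
exists e, (G == 1%N), ((x%:~R + 1 + y%:~R * s) / (2 * z%:~R * s ^+ r)); split=> //.
have srN0 : s ^+ r != 0 by rewrite expf_neq0.
rewrite expr_div_n -key x1C.
have e2 : (-1) ^+ e * (-1) ^+ e = 1 :> algC by rewrite -expr2 sqrr_sign.
have -> : forall w : algC, (-1) ^+ e * w * (2 * ((-1) ^+ e * (G%:R * z%:~R ^+ 2) * (s ^+ r) ^+ 2) *
   (a + b * s) / (2 * z%:~R * s ^+ r) ^+ 2) =
   ((-1) ^+ e * (-1) ^+ e) * (w * G%:R / 2) * (a + b * s).
  by move=> w; field; rewrite zN0 srN0.
by rewrite e2 mul1r; case: G12 => ->; rewrite ?expr1 ?expr0 ?mul1r ?mulr1 mulfV // mul1r.
Qed.

(** * Units of Q(sqrt q, sqrt P, i) *)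

Lemma quadext_fixed F (s z : algC) (nu : {rmorphism algC -> algC}) :
  (forall a, F a -> nu a = a) -> nu s = - s -> quadext F s z -> nu z = z -> F z.
Proof.
move=> fixF nus [a [b [Fa Fb ->]]].
rewrite rmorphD rmorphM nus !fixF // => /addrI/eqP.
rewrite mulrN eq_sym -addr_eq0 -mulr2n mulrn_eq0 /= => /eqP->.
by rewrite addr0.
Qed.

Lemma quadext_fix F (s : algC) (nu : {rmorphism algC -> algC}) :
  (forall a, F a -> nu a = a) -> nu s = s -> forall z, quadext F s z -> nu z = z.
Proof. by move=> fixF nus _ [a [b [Fa Fb ->]]]; rewrite rmorphD rmorphM nus !fixF. Qed.

Lemma Qfield_fix (nu : {rmorphism algC -> algC}) a : Qfield a -> nu a = a.
Proof. by move=> aQ; rewrite aut_Crat. Qed.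

Lemma rmorph_preim_subfield F (nu : {rmorphism algC -> algC}) :
  is_subfield F -> is_subfield [set z | F (nu z)].
Proof.
move=> sF; split=> /=; first by rewrite rmorph1; subfield.
  by move=> x y ? ?; rewrite rmorphB; subfield.
by move=> x y ? ?; rewrite fmorph_div; subfield.
Qed.

Lemma rmorph_eq_subfield (f g : {rmorphism algC -> algC}) :
  is_subfield [set z | f z = g z].
Proof.
split=> /=; first by rewrite !rmorph1.
  by move=> x y fx fy; rewrite !rmorphB fx fy.
by move=> x y fx fy; rewrite !fmorph_div fx fy.
Qed.

Lemma expfz_parity (z : algC) (m : int) (b : bool) : z != 0 ->
  z ^ (2 * m + b%:Z) = z ^+ b * (z ^ m) ^+ 2.
Proof. by move=> zN0; rewrite expfzDr // mulrC [(z ^ m) ^+ 2]exprnP exprz_exp (mulrC m). Qed.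

Section Biquadratic.

Variables q P : nat.
Let sq : algC := sqrtC q%:R.
Let sP : algC := sqrtC P%:R.
Let sd : algC := sqrtC (P * q)%:R.
Let k : set algC := Qadjoin [set sd; 'i].
Let K : set algC := adjoin k [set sq].

Lemma sqrtCM_natE : sd = sP * sq.
Proof. by rewrite /sd natrM sqrtCM ?nnegrE ?ler0n. Qed.

Lemma quartic_baseE : k = quadext Gauss sd.
Proof. by rewrite /k Qadjoin_sqrt2E // ?sqrtCK ?rpred_nat // sqrCi rpredN rpred1. Qed.

Lemma quartic_base_subfield : is_subfield k. Proof. exact: adjoin_subfield. Qed.

Lemma octic_subfield : is_subfield K. Proof. exact: adjoin_subfield. Qed.

Lemma octicE : K = quadext k sq.
Proof.
have sk := quartic_base_subfield.
by rewrite /K adjoin_sqrtE // sqrtCK; subfield.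
Qed.

Lemma quartic_base_sub : k `<=` K. Proof. exact: adjoin_base. Qed.

Lemma quartic_i : k 'i. Proof. by apply: adjoin_gen; right. Qed.
Lemma quartic_sd : k sd. Proof. by apply: adjoin_gen; left. Qed.
Lemma octic_sq : K sq. Proof. exact: adjoin_gen. Qed.
Lemma octic_i : K 'i. Proof. by apply: quartic_base_sub; exact: quartic_i. Qed.

Lemma octic_min G : is_subfield G -> G 'i -> G sq -> G sP -> K `<=` G.
Proof.
move=> sG Gi Gq GP; apply: adjoin_min => //; last by move=> _ ->.
apply: adjoin_min => //.
by move=> _ [->|->] //; rewrite sqrtCM_natE; subfield.
Qed.

Lemma rmorph_octic_eq (f g : {rmorphism algC -> algC}) :
  f 'i = g 'i -> f sq = g sq -> f sP = g sP -> forall z, K z -> f z = g z.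
Proof.
by move=> fi fq fP; apply: (octic_min (rmorph_eq_subfield f g)).
Qed.

Hypotheses (q_gt1 : (1 < q)%N) (P_gt1 : (1 < P)%N).
Hypotheses (sf2 : squarefree 2) (sf2q : squarefree (2 * q)).
Hypotheses (sf2P : squarefree (2 * P)) (sf2d : squarefree (2 * (P * q))).
Hypotheses (pq : prime q) (qmod : (q %% 4 = 3)%N).

Variables tau1 tau2 : {rmorphism algC -> algC}.
Hypotheses (tau1i : tau1 'i = 'i) (tau1q : tau1 sq = sq) (tau1P : tau1 sP = - sP).
Hypotheses (tau2i : tau2 'i = 'i) (tau2P : tau2 sP = sP) (tau2q : tau2 sq = - sq).

(** It changes the sign of both [sq] and [sP], so it fixes [sd] and 'i and generates the Galois
    group of K over k. *)
Let sg : {rmorphism algC -> algC} := (tau1 \o tau2)%FUN.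

Let sgi : sg 'i = 'i. Proof. by rewrite /= tau2i tau1i. Qed.
Let sgq : sg sq = - sq. Proof. by rewrite /= tau2q rmorphN tau1q. Qed.
Let sgP : sg sP = - sP. Proof. by rewrite /= tau2P tau1P. Qed.
Let sgd : sg sd = sd.
Proof. by rewrite sqrtCM_natE rmorphM sgq sgP mulrNN. Qed.

Let conjq : sq^* = sq.
Proof. by apply/CrealP; rewrite ger0_real // sqrtC_ge0 ler0n. Qed.
Let conjP : sP^* = sP.
Proof. by apply/CrealP; rewrite ger0_real // sqrtC_ge0 ler0n. Qed.

Let sqN0 : sq != 0. Proof. by rewrite sqrtC_eq0 pnatr_eq0 -lt0n ltnW. Qed.
Let sPN0 : sP != 0. Proof. by rewrite sqrtC_eq0 pnatr_eq0 -lt0n ltnW. Qed.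

Lemma octic_sP : K sP.
Proof.
have sK := octic_subfield; have Ksq := octic_sq.
have Kd := quartic_base_sub quartic_sd.
have -> : sP = sd / sq by rewrite sqrtCM_natE mulfK.
by subfield.
Qed.

Lemma octic_aut (nu : {rmorphism algC -> algC}) :
  K (nu 'i) -> K (nu sq) -> K (nu sP) -> forall z, K z -> K (nu z).
Proof.
by move=> *; apply: (octic_min (rmorph_preim_subfield nu octic_subfield)).
Qed.

Let Ksq := octic_sq.
Let KsP := octic_sP.
Let Ki := octic_i.
Let sK := octic_subfield.

Let Ktau1 z : K z -> K (tau1 z).
Proof. by apply: octic_aut; rewrite ?tau1i ?tau1q ?tau1P; subfield. Qed.
Let Ktau2 z : K z -> K (tau2 z).
Proof. by apply: octic_aut; rewrite ?tau2i ?tau2q ?tau2P; subfield. Qed.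
Let Ksg z : K z -> K (sg z).
Proof. by move=> Kz; apply: Ktau1; apply: Ktau2. Qed.
Let Kconj z : K z -> K z^*.
Proof.
by apply: (@octic_aut Num.conj); rewrite /= ?conjCi ?conjq ?conjP; subfield.
Qed.

Let tau1K z : K z -> tau1 (tau1 z) = z.
Proof.
apply: (@rmorph_octic_eq (tau1 \o tau1)%FUN idfun); rewrite /= ?tau1i ?tau1q //.
by rewrite tau1P rmorphN tau1P opprK.
Qed.
Let tau2K z : K z -> tau2 (tau2 z) = z.
Proof.
apply: (@rmorph_octic_eq (tau2 \o tau2)%FUN idfun); rewrite /= ?tau2i ?tau2P //.
by rewrite tau2q rmorphN tau2q opprK.
Qed.
Let tau12C z : K z -> tau1 (tau2 z) = tau2 (tau1 z).
Proof.
apply: (@rmorph_octic_eq (tau1 \o tau2)%FUN (tau2 \o tau1)%FUN); rewrite /=.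
- by rewrite tau2i tau1i tau2i.
- by rewrite tau2q tau1q tau2q rmorphN tau1q.
- by rewrite tau2P tau1P rmorphN tau2P.
Qed.
Lemma octic_involution z : K z -> sg (sg z) = z.
Proof.
by move=> Kz /=; rewrite -(tau12C (Ktau2 Kz)) tau2K // tau1K.
Qed.

Let conj_tau (nu : {rmorphism algC -> algC}) z :
  nu 'i = 'i -> (nu sq)^* = nu sq -> (nu sP)^* = nu sP ->
  K z -> nu z^* = (nu z)^*.
Proof.
move=> nui nuq nuP; apply: (@rmorph_octic_eq (nu \o Num.conj)%FUN (Num.conj \o nu)%FUN) => /=.
- by rewrite conjCi rmorphN nui conjCi.
- by rewrite conjq nuq.
- by rewrite conjP nuP.
Qed.
Let conj_tau1 z : K z -> tau1 z^* = (tau1 z)^*.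
Proof. by apply: conj_tau; rewrite ?tau1q ?tau1P ?rmorphN /= ?conjq ?conjP. Qed.
Let conj_tau2 z : K z -> tau2 z^* = (tau2 z)^*.
Proof. by apply: conj_tau; rewrite ?tau2q ?tau2P ?rmorphN /= ?conjq ?conjP. Qed.
Let conj_sg z : K z -> sg z^* = (sg z)^*.
Proof. by move=> Kz /=; rewrite conj_tau2 // conj_tau1 //; apply: Ktau2. Qed.

Lemma quartic_fix z : k z -> sg z = z.
Proof.
rewrite quartic_baseE; apply: quadext_fix sgd _ => a.
by apply: quadext_fix sgi a => b; apply: Qfield_fix.
Qed.

Lemma octic_fixed z : K z -> sg z = z -> k z.
Proof. by rewrite octicE; apply: quadext_fixed sgq => a; apply: quartic_fix. Qed.

Let Qq := quadext Qfield sq.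
Let QP := quadext Qfield sP.
Let sQ := Qfield_subfield.
Let sQq : is_subfield Qq.
Proof. by apply: quadext_subfield => //; rewrite sqrtCK; subfield. Qed.
Let sQP : is_subfield QP.
Proof. by apply: quadext_subfield => //; rewrite sqrtCK; subfield. Qed.

Let QqK : Qq `<=` K.
Proof.
move=> _ [a [b [aQ bQ ->]]].
by subfield; [apply: (subfield_Crat sK aQ)|apply: (subfield_Crat sK bQ)].
Qed.

(* Q(sqrt q, sqrt P) is viewed as an extension of either of its two quadratic
   subfields s = sq, t = sP or s = sP, t = sq. *)
Let real_quadext F s t z : (s = sq /\ t = sP \/ s = sP /\ t = sq) ->
  F = quadext Qfield s -> K z -> z^* = z -> quadext F t z.
Proof.
move=> st -> {F} Kz zR.
have sF : is_subfield (quadext Qfield s) by case: st => -[-> _].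
have t2 : quadext Qfield s (t ^+ 2).
  by case: st => -[_ ->]; rewrite sqrtCK; subfield.
have sG := quadext_subfield sF t2.
have sH : is_subfield (quadext (quadext (quadext Qfield s) t) 'i).
  by apply: quadext_subfield => //; rewrite sqrCi; subfield.
have Gs : quadext (quadext Qfield s) t s.
  by apply: quadext_base => //; apply: quadext_gen.
have Gt : quadext (quadext Qfield s) t t by apply: quadext_gen.
have realF w : quadext Qfield s w -> w^* = w.
  by apply: (@quadext_fix _ _ Num.conj) => [a|]; [apply: Qfield_fix | case: st => -[-> _]].
have realG w : quadext (quadext Qfield s) t w -> w^* = w.
  by apply: (@quadext_fix _ _ Num.conj) => [a|]; [apply: realF | case: st => -[_ ->]].
have KH : K `<=` quadext (quadext (quadext Qfield s) t) 'i.
  apply: octic_min => //; first exact: quadext_gen.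
    by apply: quadext_base => //; case: st => -[sE tE]; [rewrite -sE | rewrite -tE].
  by apply: quadext_base => //; case: st => -[sE tE]; [rewrite -tE | rewrite -sE].
apply: (quadext_fixed (nu := Num.conj) realG _ (KH _ Kz) zR).
exact: conjCi.
Qed.

Let real_tau1 z : K z -> z^* = z -> tau1 z = z -> Qq z.
Proof.
move=> Kz zR; apply: quadext_fixed tau1P _.
  by apply: quadext_fix tau1q => b; apply: Qfield_fix.
by apply: real_quadext Kz zR; [left | ].
Qed.

Let real_tau2 z : K z -> z^* = z -> tau2 z = z -> QP z.
Proof.
move=> Kz zR; apply: quadext_fixed tau2q _.
  by apply: quadext_fix tau2P => b; apply: Qfield_fix.
by apply: real_quadext Kz zR; [right | ].
Qed.

Let rational_tau1 z : K z -> z^* = z -> tau1 z = z -> sg z = z -> z \in Crat.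
Proof.
move=> Kz zR z1 zs; have := real_tau1 Kz zR z1.
by move=> /(quadext_fixed (nu := sg)) H; apply: H => // a; apply: Qfield_fix.
Qed.

Let rational_tau2 z : K z -> z^* = z -> tau2 z = z -> sg z = z -> z \in Crat.
Proof.
move=> Kz zR z1 zs; have := real_tau2 Kz zR z1.
by move=> /(quadext_fixed (nu := sg)) H; apply: H => // a; apply: Qfield_fix.
Qed.

(** Each automorphism sends a root w of 2 to w or -w. According to the signs under [tau1] and [sg],
    multiplying w by 1, sqrt q, sqrt (P q) or sqrt P gives an invariant real number; it would be a
    rational square root of 2, 2q, 2Pq or 2P. *)
Let sqrt2_notin w : K w -> w^* = w -> w ^+ 2 <> 2.
Proof.
move=> Kw wR w2.
have sgn (nu : {rmorphism algC -> algC}) : nu w = w \/ nu w = - w.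
  have /eqP : (nu w) ^+ 2 = w ^+ 2 by rewrite -rmorphXn w2 rmorph_nat.
  by rewrite eqf_sqr => /orP[]/eqP; [left | right].
have notQ (n : nat) t : squarefree (2 * n) -> (0 < n)%N -> t ^+ 2 = n%:R ->
    K t -> t^* = t -> tau1 (w * t) = w * t -> sg (w * t) = w * t -> False.
  move=> sfn n_gt0 tE Kt tR w1 ws.
  apply: (@Crat_sqr_neq (2 * n) (w * t)) => //; first by lia.
    by apply: rational_tau1 => //; [subfield | rewrite rmorphM /= wR tR].
  by rewrite exprMn w2 tE natrM.
have [w1|w1] := sgn tau1; have [ws|ws] := sgn sg.
- apply: (@notQ 1%N 1); rewrite ?mulr1 ?expr1n ?muln1 ?rmorph1 //; by subfield.
- apply: (@notQ q sq); rewrite ?sqrtCK ?(ltnW q_gt1) //.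
  + by rewrite rmorphM w1 tau1q.
  + by rewrite rmorphM ws sgq mulrNN.
- apply: (@notQ (P * q)%N sd); rewrite ?sqrtCK ?muln_gt0 ?(ltnW q_gt1) ?(ltnW P_gt1) //.
  + by rewrite sqrtCM_natE; subfield.
  + by rewrite sqrtCM_natE rmorphM /= conjq conjP.
  + by rewrite sqrtCM_natE rmorphM w1 rmorphM tau1q tau1P; ring.
  + by rewrite rmorphM ws sgd.
- apply: (@notQ P sP); rewrite ?sqrtCK ?(ltnW P_gt1) //.
  + by rewrite rmorphM w1 tau1P mulrNN.
  + by rewrite rmorphM ws sgP mulrNN.
Qed.

(* z nu(z) is a unit of an imaginary quadratic field: its trace is a rational
   integer of absolute value at most 2. *)
Let cube_eq_sign (nu : {rmorphism algC -> algC}) z :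
    (forall z, K z -> K (nu z)) -> (forall z, K z -> nu (nu z) = z) ->
    (forall z, K z -> nu z^* = (nu z)^*) -> (forall z, K z -> nu (sg z) = sg (nu z)) ->
    (forall z, K z -> z^* = z -> nu z = z -> sg z = z -> z \in Crat) ->
    K z -> z \in Aint -> z * z^* = 1 -> z * sg z = 1 ->
  (z * nu z) ^+ 3 = 1 \/ (z * nu z) ^+ 3 = -1.
Proof.
move=> Knu nuK conj_nu nu_sg ratl Kz Az zz zsz; set u := z * nu z.
have Kn := Knu _ Kz.
have Ku : K u by rewrite /u; subfield.
have Kuc := Kconj Ku.
have nn : nu z * (nu z)^* = 1 by rewrite -conj_nu // -rmorphM zz rmorph1.
have nsn : nu z * sg (nu z) = 1 by rewrite -nu_sg // -rmorphM zsz rmorph1.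
have uu : u * u^* = 1.
  by rewrite /u rmorphM /= -[RHS]mulr1 -{1}zz -nn; ring.
have usu : u * sg u = 1.
  by rewrite /u rmorphM -[RHS]mulr1 -{1}zsz -nsn; ring.
have uN0 : u != 0 by apply/eqP => u0; move: uu; rewrite u0 mul0r => /eqP; rewrite eq_sym oner_eq0.
have sgu : sg u = u^* by apply: (mulfI uN0); rewrite usu uu.
have nuu : nu u = u by rewrite /u rmorphM nuK // mulrC.
have Au : u \in Aint by rewrite rpredM ?Aint_aut.
have Auc : u^* \in Aint by rewrite (Aint_aut Num.conj).
have /intrP[c cE] : u + u^* \in Num.int.
  apply: Cint_rat_Aint; last by rewrite rpredD.
  apply: ratl; first by subfield.
  - by rewrite rmorphD /= conjCK addrC.
  - by rewrite rmorphD conj_nu // nuu.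
  - by rewrite rmorphD conj_sg // sgu conjCK addrC.
have u2 : u ^+ 2 = c%:~R * u - 1 by rewrite -cE -uu; ring.
have norm_u : `|u| = 1.
  by apply/eqP; rewrite -sqrp_eq1 // normCK uu.
have c_le2 : `|c| <= 2.
  rewrite -(ler_int algC) intr_norm -cE (le_trans (ler_normD _ _)) //.
  by rewrite norm_conjC norm_u.
have u3 : u ^+ 3 = u * (c%:~R * u - 1) by rewrite -u2; ring.
have cases : c = 0 \/ c = 1 \/ c = -1 \/ c = 2 \/ c = -2 by move: c_le2; lia.
case: cases => [|[|[|[]]]] c0; rewrite c0 ?mulr0z ?mulr1z ?mulrN1z in u2 u3.
(* Trace 0 means that u is i or -i, which [sg] fixes; then u times [sg u] is -1, contradicting
   [usu]. *)
- have : (u - 'i) * (u + 'i) = 0.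
    by transitivity (u ^+ 2 - 'i ^+ 2); [ring | rewrite u2 sqrCi; ring].
  move=> /eqP; rewrite mulf_eq0 subr_eq0 addr_eq0 => uE.
  have : sg u = u by case/orP: uE => /eqP ->; rewrite ?rmorphN sgi.
  move=> sguu; move: usu; rewrite sguu -expr2 u2 mul0r sub0r => /eqP.
  by rewrite -subr_eq0 -opprD oppr_eq0 -(natrD _ 1 1) pnatr_eq0.
- right; rewrite u3; transitivity (u ^+ 2 - u); first by ring.
  by rewrite u2; ring.
- left; rewrite u3; transitivity (- u ^+ 2 - u); first by ring.
  by rewrite u2; ring.
- left; have : (u - 1) ^+ 2 = 0.
    by transitivity (u ^+ 2 - 2 * u + 1); [ring | rewrite u2; ring].
  by move/eqP; rewrite sqrf_eq0 subr_eq0 => /eqP ->; rewrite expr1n.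
- right; have : (u + 1) ^+ 2 = 0.
    by transitivity (u ^+ 2 + 2 * u + 1); [ring | rewrite u2; ring].
  by move/eqP; rewrite sqrf_eq0 addr_eq0 => /eqP ->; ring.
Qed.

Variable eps : algC.
Hypotheses (eps_fund : is_fundamental_unit P eps) (eps_norm : eps * tau1 eps = -1).

Let quadfieldE : quadfield P = QP.
Proof. by rewrite /quadfield Qadjoin_sqrtE // sqrtCK rpred_nat. Qed.

Let QPK : QP `<=` K.
Proof.
move=> _ [a [b [aQ bQ ->]]].
by subfield; [apply: (subfield_Crat sK aQ)|apply: (subfield_Crat sK bQ)].
Qed.

Lemma fundamental_unit_octic : K eps.
Proof. by case: eps_fund => -[[Qe _] _ _] _ _; apply: QPK; rewrite -quadfieldE. Qed.

Let Keps := fundamental_unit_octic.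

Let epsN0 : eps != 0. Proof. by case: eps_fund => -[]. Qed.

Let eps_real : eps^* = eps.
Proof. by case: eps_fund => _ e1 _; apply/CrealP; rewrite gtr0_real // (lt_trans ltr01). Qed.

(** The norms [uP] and [uq] are, up to sign, eps^(2m) and 2^j t^2 with t in Q(sqrt q), and their
    product is r^2 up to sign. So w = r / (t eps^m) is real with square 1 or 2 up to sign; since
    sqrt 2 is not in K, w is 1 or -1. It remains to treat t, again a unit of Q(sqrt q). *)
Let unit_r r : K r -> r^* = r -> r \in Aint -> r^-1 \in Aint -> r != 0 ->
  (r * sg r) ^+ 2 = 1 ->
  exists (l : nat) (d : bool) s, [/\ K s, s != 0 & r = 'i ^+ l * eps ^+ d * s ^+ 2].
Proof.
move=> Kr rR rA rVA rN0 rsr.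
have Kr1 := Ktau1 Kr; have Kr2 := Ktau2 Kr.
have Krs := Ksg Kr.
pose uq := r * tau1 r; pose uP := r * tau2 r.
have Quq : Qq uq.
  apply: real_tau1; first by rewrite /uq; subfield.
    by rewrite /uq rmorphM /= -conj_tau1 // rR.
  by rewrite /uq rmorphM tau1K // mulrC.
have QuP : QP uP.
  apply: real_tau2; first by rewrite /uP; subfield.
    by rewrite /uP rmorphM /= -conj_tau2 // rR.
  by rewrite /uP rmorphM tau2K // mulrC.
have s0E : exists e0 : bool, r * sg r = (-1) ^+ e0.
  move/eqP: rsr; rewrite sqrf_eq1 => /orP[]/eqP ->; first by exists false.
  by exists true.
have [e0 s0] := s0E.
have t12 : tau1 r * tau2 r = (-1) ^+ e0.
  have := congr1 tau1 s0; rewrite rmorphM rmorph_sign => <-; congr (_ * _).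
  by rewrite /= tau1K.
have norm_uP : uP * tau1 uP = 1.
  have -> : uP * tau1 uP = (r * sg r) * (tau1 r * tau2 r).
    by rewrite /uP rmorphM /=; ring.
  by rewrite s0 t12 -expr2 sqrr_sign.
have uqP : uq * uP = (-1) ^+ e0 * r ^+ 2 by rewrite -t12 /uq /uP; ring.
have uqN0 : uq != 0 by rewrite mulf_neq0 ?fmorph_eq0.
have uPN0 : uP != 0 by rewrite mulf_neq0 ?fmorph_eq0.
have Auq : uq \in Aint by rewrite rpredM ?Aint_aut.
have AuP : uP \in Aint by rewrite rpredM ?Aint_aut.
have AuqV : uq^-1 \in Aint by rewrite invfM -fmorphV rpredM ?Aint_aut.
have AuPV : uP^-1 \in Aint by rewrite invfM -fmorphV rpredM ?Aint_aut.
have [n [e1 uPE]] : exists (n : int) (e1 : bool), uP = (-1) ^+ e1 * eps ^ n.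
  case: eps_fund => _ _ /(_ uP)[|n [->|->]].
  - by split; rewrite // quadfieldE; split=> //; subfield.
  - by exists n, false; rewrite mul1r.
  - by exists n, true; rewrite expr1 mulN1r.
have [m [b nE]] := int_parity n.
have expz_even (z : algC) : z != 0 -> z ^ n = z ^+ b * (z ^ m) ^+ 2.
  by move=> zN0; rewrite nE expfz_parity.
(* An odd power of eps has norm -1, whereas [uP] has norm 1. *)
have bF : b = false.
  move: norm_uP; rewrite uPE rmorphM rmorph_sign fmorphXz mulrACA -expr2 sqrr_sign mul1r.
  rewrite -expfzMl eps_norm expz_even ?oppr_eq0 ?oner_eq0 //.
  have -> : ((-1) ^ m) ^+ 2 = 1 :> algC.
    by rewrite exprnP exprz_exp mulrC -exprz_exp -[_ ^ 2]exprnP sqrrN expr1n exp1rz.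
  rewrite mulr1; case: b {nE expz_even} => // /eqP.
  by rewrite expr1 eq_sym -subr_eq0 opprK -(natrD _ 1 1) pnatr_eq0.
have [e2 [j [t [Qt tN0 uqE]]]] := quad_unit_square pq qmod tau2q Quq uqN0 Auq AuqV.
have Kt := QqK Qt.
have emN0 : eps ^ m != 0 by rewrite expfz_neq0.
have Rt : t^* = t.
  by move: Qt; apply: (@quadext_fix _ _ Num.conj) => // a; apply: Qfield_fix.
have Rem : (eps ^ m)^* = eps ^ m.
  by rewrite (fmorphXz Num.conj) /= eps_real.
pose w := r / (t * eps ^ m).
have Kw : K w by rewrite /w; subfield.
have wN0 : w != 0 by rewrite !mulf_neq0 ?invr_neq0 ?mulf_neq0.
have Rw : w^* = w by rewrite /w fmorph_div /= rmorphM /= rR Rt Rem.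
have rE : r = w * (t * eps ^ m) by rewrite divfK // mulf_neq0.
pose sgn := (-1) ^+ e0 * (-1) ^+ e1 * (-1) ^+ e2 : algC.
have w2 : w ^+ 2 = sgn * 2 ^+ j.
  have : (-1) ^+ e0 * (-1) ^+ e0 * r ^+ 2 = sgn * 2 ^+ j * (t * eps ^ m) ^+ 2.
    rewrite -mulrA -uqP uqE uPE expz_even // bF /sgn; ring.
  rewrite -expr2 sqrr_sign mul1r => r2.
  by rewrite /w expr_div_n r2 mulfK // expf_neq0 // mulf_neq0.
have sgn1 : sgn = 1.
  have : 0 <= w ^+ 2 by rewrite expr2 -{2}Rw mul_conjC_ge0.
  rewrite w2 /sgn -!signr_addb; case: (_ (+) _) => //.
  by rewrite expr1 mulN1r oppr_ge0 lt_geF // exprn_gt0 // ltr0n.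
have j0 : j = false.
  case: j uqE w2 => // _; rewrite sgn1 mul1r expr1.
  by move=> w2; case: (sqrt2_notin Kw Rw).
have [e3 wE] : exists e3 : bool, w = (-1) ^+ e3.
  move/eqP: w2; rewrite sgn1 j0 mulr1 sqrf_eq1 => /orP[]/eqP->; first by exists false.
  by exists true.
have t2E : t ^+ 2 = (-1) ^+ e2 * uq.
  by rewrite uqE j0 mulr1 mulrA -expr2 sqrr_sign mul1r.
have At : t \in Aint by apply: Aint_sqr; rewrite t2E rpredM // rpred_sign.
have AtV : t^-1 \in Aint.
  apply: Aint_sqr; rewrite exprVn t2E invfM rpredM //.
  by rewrite -exprVn invrN1 rpred_sign.
(* Second use: r contains t itself, not its square, so t must also be reduced modulo squares. *)
have [e4 [j' [t' [Qt' t'N0 tE]]]] := quad_unit_square pq qmod tau2q Qt tN0 At AtV.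
have Kt' := QqK Qt'.
have [m' [b' mE]] := int_parity m.
have em'N0 : eps ^ m' != 0 by rewrite expfz_neq0.
have emE : eps ^ m = eps ^+ b' * (eps ^ m') ^+ 2.
  by rewrite mE expfz_parity.
have i2 := sqrCi algC.
have i1N0 := Ci1_neq0.
(* The signs of w and t enter as powers of i^2, and a factor 2 as i^3 (1 + i)^2. *)
exists (2 * e3 + 2 * e4 + 3 * j')%N, b', ((1 + 'i) ^+ j' * t' * eps ^ m'); split.
- by subfield.
- by rewrite !mulf_neq0 // expf_neq0.
- rewrite rE wE tE emE 2!exprD !exprM i2.
  have -> : 2 ^+ j' = ('i ^+ 3) ^+ j' * ((1 + 'i) ^+ j') ^+ 2 :> algC.
    by case: (j') => /=; rewrite ?expr1 ?expr0 ?expr1n ?mulr1 // -two_eq_i3_sqr.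
  by ring.
Qed.

(** The quotient z of eta by its conjugate is shown to satisfy z^3 = 1 or -1. Then eta z is real or
    purely imaginary, a power of i turns it into a real unit covered by [unit_r], and z is a square
    up to sign. *)
Lemma octic_unit_square eta : is_unit K eta -> eta * sg eta = 1 ->
  exists (l : nat) (d : bool) s,
    [/\ K s, s != 0 & eta = 'i ^+ l * eps ^+ d * s ^+ 2].
Proof.
move=> [[Ke Ae] eN0 [_ AeV]] ese.
have ecN0 : eta^* != 0 by rewrite conjC_eq0.
have Kec := Kconj Ke.
pose z := eta / eta^*.
have Kz : K z by rewrite /z; subfield.
have Az : z \in Aint.
  by rewrite /z rpredM // -(fmorphV Num.conj) (Aint_aut Num.conj).
have AzV : z^-1 \in Aint.
  by rewrite /z invfM invrK rpredM // (Aint_aut Num.conj).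
have zN0 : z != 0 by rewrite mulf_neq0 ?invr_neq0.
have zz : z * z^* = 1.
  by rewrite /z fmorph_div /= conjCK; field; rewrite eN0 ecN0.
have ecse : eta^* * sg eta^* = 1.
  by rewrite conj_sg // -(rmorphM Num.conj) ese rmorph1.
have zsz : z * sg z = 1.
  by rewrite /z fmorph_div mulrACA ese -invfM ecse invr1 mulr1.
have nuC1 x : K x -> tau1 (sg x) = sg (tau1 x).
  by move=> Kx /=; rewrite -(tau12C Kx).
have nuC2 x : K x -> tau2 (sg x) = sg (tau2 x).
  by move=> Kx /=; rewrite -tau12C //; apply: Ktau2.
have c1 := cube_eq_sign Ktau1 tau1K conj_tau1 nuC1 rational_tau1 Kz Az zz zsz.
have c2 := cube_eq_sign Ktau2 tau2K conj_tau2 nuC2 rational_tau2 Kz Az zz zsz.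
(* Applying [tau1] to z [sg z] = 1 gives [tau1 z] [tau2 z] = 1. *)
have z2 : z ^+ 2 = (z * tau1 z) * (z * tau2 z).
  have : tau1 (z * sg z) = 1 by rewrite zsz rmorph1.
  rewrite rmorphM [sg z]/= tau1K; last exact: Ktau2.
  by move=> t12; rewrite -[LHS]mulr1 -t12; ring.
pose x := z ^+ 3.
have x2 : x ^+ 2 = 1 \/ x ^+ 2 = -1.
  have -> : x ^+ 2 = (z * tau1 z) ^+ 3 * (z * tau2 z) ^+ 3.
    by rewrite -exprMn -z2 /x; ring.
  by case: c1 => ->; case: c2 => ->; rewrite ?mulr1 ?mul1r ?mulrNN ?mulr1; auto.
have xsx : x * sg x = 1 by rewrite /x rmorphXn -exprMn zsz expr1n.
have x2E : x ^+ 2 = 1.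
  (* If x^2 = -1, then x is i or -i and is fixed by [sg], against x [sg x] = 1. *)
  case: x2 => // x2; have : (x - 'i) * (x + 'i) = 0.
    by transitivity (x ^+ 2 - 'i ^+ 2); [ring | rewrite x2 sqrCi; ring].
  move=> /eqP; rewrite mulf_eq0 subr_eq0 addr_eq0 => xE.
  suff sgx : sg x = x by rewrite expr2 -{2}sgx.
  by case/orP: xE => /eqP ->; rewrite ?rmorphN sgi.
have [e xE] : exists e : bool, x = (-1) ^+ e.
  move/eqP: x2E; rewrite sqrf_eq1 => /orP[]/eqP ->; first by exists false.
  by exists true.
have i2 := sqrCi algC.
have iN0 := neq0Ci algC.
pose r := 'i ^+ e * (eta * z).
have iA : 'i \in Aint by apply: Aint_sqr; rewrite i2 rpredN rpred1.
have iVA : 'i^-1 \in Aint by rewrite invCi rpredN.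
have etaz : (eta * z)^* = (-1) ^+ e * (eta * z).
  have -> : (eta * z)^* = eta^* * z^* by rewrite rmorphM.
  have zcE : z^* = z^-1 by apply: (mulfI zN0); rewrite zz mulfV.
  have etaE : eta = eta^* * z by rewrite /z mulrC divfK.
  have x3 : (-1) ^+ e * z ^+ 3 = 1 by rewrite -/x xE -expr2 sqrr_sign.
  transitivity ((-1) ^+ e * (eta^* * z * z)); last by rewrite -etaE.
  transitivity (eta^* / z * ((-1) ^+ e * z ^+ 3)); first by rewrite x3 mulr1 zcE.
  by field; exact: zN0.
have [l [d [s [Ks sN0 rE]]]] : exists (l : nat) (d : bool) s,
    [/\ K s, s != 0 & r = 'i ^+ l * eps ^+ d * s ^+ 2].
  apply: unit_r.
  - by rewrite /r; subfield.
  - rewrite /r rmorphM /= etaz rmorphXn /= conjCi mulrA -exprMn.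
    by rewrite mulrN1 opprK.
  - by rewrite rpredM ?rpredX // rpredM.
  - by rewrite /r 2!invfM -exprVn !rpredM ?rpredX.
  - by apply: mulf_neq0; [apply: expf_neq0 | apply: mulf_neq0].
  - have -> : r * sg r = ('i ^+ e) ^+ 2 * ((eta * sg eta) * (z * sg z)).
      by rewrite /r rmorphM rmorphXn sgi rmorphM; ring.
    by rewrite ese zsz !mulr1 exprAC i2 sqrr_sign.
(* eta = r / (i^e z): the exponent 3e inverts i^e, and 2e is the sign in z^-1 = (-1)^e z^2. *)
exists (l + 3 * e + 2 * e)%N, d, (s * z); split.
- by subfield.
- by rewrite mulf_neq0.
- have i4 : ('i ^+ 3) ^+ e * 'i ^+ e = 1 :> algC.
    have i31 : 'i ^+ 3 * 'i = 1 :> algC.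
      by transitivity (('i ^+ 2) ^+ 2 : algC); [ring | rewrite i2; ring].
    by rewrite -exprMn i31 expr1n.
  have x3 : (-1) ^+ e * z ^+ 3 = 1 by rewrite -/x xE -expr2 sqrr_sign.
  rewrite 2!exprD !exprM i2.
  transitivity (('i ^+ 3) ^+ e * ('i ^+ l * eps ^+ d * s ^+ 2) * (-1) ^+ e * z ^+ 2); last by ring.
  transitivity (eta * (('i ^+ 3) ^+ e * 'i ^+ e) * ((-1) ^+ e * z ^+ 3)).
    by rewrite i4 x3 !mulr1.
  by rewrite -rE /r; ring.
Qed.

End Biquadratic.

(** * Square classes in Q(i) and ramified primes *)

Lemma dvdn_mul_prime_split (G m p : nat) : prime p -> (G %| m * p)%N ->
  exists (b : bool) (G' : nat), (G' %| m)%N /\ G = (G' * p ^ b)%N.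
Proof.
move=> pp Gmp; have [pG|pG] := boolP (p %| G)%N.
  exists true, (G %/ p)%N; rewrite expn1 divnK //; split=> //.
  by rewrite -(@dvdn_pmul2r p) ?prime_gt0 // divnK.
exists false, G; rewrite expn0 muln1; split=> //.
by rewrite -(@Gauss_dvdl _ m p) // coprime_sym prime_coprime.
Qed.

(** The values of 2G are 2, 4 and 8, and 2 = i^3 (1 + i)^2. *)
Lemma dvdn4_i_sqr (G : nat) : (G %| 4)%N ->
  exists (l : nat) (t : algC), [/\ Gauss t, t != 0 & 2 * G%:R = 'i ^+ l * t ^+ 2].
Proof.
have sG := Gauss_subfield.
have Gi : Gauss 'i by apply: quadext_gen; apply: Qfield_subfield.
have n2 : 2 != 0 :> algC by rewrite pnatr_eq0.
have i1 := Ci1_neq0.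
case: G => [|[|[|[|[|G]]]]] // G4.
- exists 3%N, (1 + 'i); split=> //; first by subfield.
  by rewrite mulr1 {1}two_eq_i3_sqr.
- exists 0%N, 2; split=> //; first by subfield.
  by rewrite expr0 mul1r expr2.
- exists 3%N, (2 * (1 + 'i)); split; first by subfield.
    by rewrite mulf_neq0.
  transitivity (2 * (2 * 2) : algC); first by ring.
  by rewrite {1}two_eq_i3_sqr; ring.
Qed.

(* z = (u + 2i) pi1 pi3 has norm n^2 and trace 2A, so that 2 (n + A) z is the
   square of z + n; the gcd of n + A and n - A divides 4 p1 p2. *)
Lemma Gauss_square_class (p1 p2 : nat) (e f g h u v : int) :
    prime p1 -> prime p2 -> p1%:Z = e ^+ 2 + 4 * f ^+ 2 ->
    p2%:Z = g ^+ 2 + 4 * h ^+ 2 -> u ^+ 2 + 4 = (p1 * p2)%N%:Z * v ^+ 2 ->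
  let z : algC := (u%:~R + 2 * 'i) *
           ((e%:~R + 2 * 'i * f%:~R) * (g%:~R + 2 * 'i * h%:~R)) in
  exists (l : nat) (b1 b2 : bool) (t : algC), [/\ Gauss t, t != 0 &
    z * ('i ^+ l * p1%:R ^+ b1 * p2%:R ^+ b2) = t ^+ 2].
Proof.
move=> pp1 pp2 p1E p2E uvE z.
have p1_gt0 := prime_gt0 pp1; have p2_gt0 := prime_gt0 pp2.
have i2 := sqrCi algC.
(* Real and imaginary parts: pi1 pi3 = c + c2 i and z = A + B i. *)
pose c := e * g - 4 * (f * h); pose c2 := 2 * (e * h + f * g).
pose A := u * c - 2 * c2; pose B := u * c2 + 2 * c.
pose P := (p1 * p2)%N%:Z.
have PE : c ^+ 2 + c2 ^+ 2 = P by rewrite /P PoszM p1E p2E /c /c2; ring.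
have P_gt0 : 0 < P by rewrite /P ltz_nat muln_gt0 p1_gt0.
have n2E : A ^+ 2 + B ^+ 2 = (P * v) ^+ 2.
  transitivity ((u ^+ 2 + 4) * (c ^+ 2 + c2 ^+ 2)); first by rewrite /A /B; ring.
  by rewrite uvE PE -/P; ring.
have vN0 : v != 0.
  by apply: contraPneq uvE => ->; rewrite expr0n mulr0; have := sqr_ge0 u; lia.
(* Both signs of P v are available for n, and they are distinct, so one avoids n = -A. *)
have [n [nE nAN0]] : exists n, A ^+ 2 + B ^+ 2 = n ^+ 2 /\ n + A != 0.
  have [nA0|nAN0] := eqVneq (P * v + A) 0; last by exists (P * v).
  exists (- (P * v)); split; first by rewrite n2E; ring.
  have -> : A = - (P * v) by apply/eqP; rewrite -addr_eq0 addrC nA0.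
  by rewrite -opprD oppr_eq0 -mulr2n mulrn_eq0 /= mulf_neq0 // gt_eqF.
have [|G [s [e0 [nAE G1 G2 G3]]]] := @mul_sqr_gcd (n + A) (n - A) B _ nAN0.
  have -> : (n + A) * (n - A) = n ^+ 2 - A ^+ 2 by ring.
  by rewrite -nE; ring.
(* G divides 2A and B; the combination 2 c B - c2 (2A) eliminates u and leaves 4P. *)
have G4P : (G %| 4 * p1 * p2)%N.
  have GA : (G%:Z %| 2 * A)%Z.
    have -> : 2 * A = (n + A) - (n - A) by ring.
    by apply: rpredB.
  have GB : (G%:Z %| B)%Z by [].
  have : (G%:Z %| 2 * c * B - c2 * (2 * A))%Z.
    by apply: rpredB; apply: dvdz_mull.
  have -> : 2 * c * B - c2 * (2 * A) = 4 * P by rewrite -PE /A /B; ring.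
  by rewrite /P -PoszM dvdzE /= mulnA.
have [b2 [G' [G'd GE]]] := dvdn_mul_prime_split pp2 G4P.
have [b1 [G0 [G0d G'E]]] := dvdn_mul_prime_split pp1 G'd.
have [l [t [Gt tN0 tE]]] := dvdn4_i_sqr G0d.
have zE : z = A%:~R + B%:~R * 'i.
  rewrite /z /A /B /c /c2 !(rmorphB, rmorphD, rmorphM) /=.
  transitivity ((u%:~R * (e%:~R * g%:~R + 4 * (f%:~R * h%:~R) * 'i ^+ 2) +
     4 * (e%:~R * h%:~R + f%:~R * g%:~R) * 'i ^+ 2) +
     (u%:~R * (2 * (e%:~R * h%:~R + f%:~R * g%:~R)) + 2 * (e%:~R * g%:~R + 4 * (f%:~R * h%:~R) * 'i ^+ 2)) * 'i : algC); first by ring.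
  by rewrite i2; ring.
clearbody A B z.
have nEC : A%:~R ^+ 2 + B%:~R ^+ 2 = n%:~R ^+ 2 :> algC.
  by rewrite -!rmorphXn -rmorphD /= nE.
have key : z * (2 * (n + A)%:~R) = (z + n%:~R) ^+ 2.
  rewrite zE intrD.
  have -> : (A%:~R + B%:~R * 'i + n%:~R) ^+ 2 = 2 * n%:~R * (A%:~R + B%:~R * 'i)
     + n%:~R ^+ 2 + A%:~R ^+ 2 + 2 * A%:~R * B%:~R * 'i + B%:~R ^+ 2 * 'i ^+ 2 :> algC by ring.
  by rewrite -nEC i2; ring.
have sN0 : s%:~R != 0 :> algC.
  rewrite intr_eq0; apply: contraNneq nAN0 => s0.
  by rewrite nAE s0 expr0n /= !mulr0.
have zN0 : z != 0.
  apply/eqP => z0; have /eqP : A%:~R ^+ 2 + B%:~R ^+ 2 = 0 :> algC.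
    transitivity (z * (A%:~R - B%:~R * 'i)); last by rewrite z0 mul0r.
    by rewrite zE; transitivity (A%:~R ^+ 2 - B%:~R ^+ 2 * 'i ^+ 2 : algC); [rewrite i2|]; ring.
  rewrite nEC sqrf_eq0 intr_eq0 => /eqP n0.
  have /eqP : P * v = 0 by move/eqP: n2E; rewrite nE n0 expr0n eq_sym sqrf_eq0 => /eqP.
  by rewrite mulf_eq0 (negPf vN0) gt_eqF.
have sG := Gauss_subfield.
have Gi : Gauss 'i by apply: quadext_gen; apply: Qfield_subfield.
have Gz : Gauss z by rewrite zE; subfield.
have tzN0 : z + n%:~R != 0.
  by rewrite -sqrf_eq0 -key !mulf_neq0 ?pnatr_eq0 // intr_eq0.
exists (l + 2 * e0)%N, b1, b2, ((z + n%:~R) / (s%:~R * t)); split.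
- by subfield.
- by rewrite mulf_neq0 ?invr_neq0 ?mulf_neq0.
have nAC : (n + A)%:~R =
    (-1) ^+ e0 * (G0%:R * p1%:R ^+ b1 * p2%:R ^+ b2 * s%:~R ^+ 2) :> algC.
  rewrite nAE intrM rmorph_sign [X in _ * X]intrM rmorphXn /= -pmulrn GE G'E.
  by rewrite !natrM !natrX.
rewrite expr_div_n -key nAC exprD exprM i2.
transitivity (z * ((-1) ^+ e0 * p1%:R ^+ b1 * p2%:R ^+ b2) * ('i ^+ l * t ^+ 2) * s%:~R ^+ 2 / (s%:~R * t) ^+ 2).
  by field; rewrite tN0 sN0.
by rewrite -tE; congr (_ / _); ring.
Qed.

(** [Gauss_square_class] leaves a factor p1^b1 p2^b2. If b1 = b2, it is a power of P, a square in F.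
    Otherwise it is p2 modulo squares of F, and p2 = pi3 pi4 replaces pi3 by pi4; [j] records this
    case. *)
Lemma eps_square_class (p1 p2 : nat) (e f g h u v : int) (F : set algC) (a b : algC) :
    prime p1 -> prime p2 -> p1%:Z = e ^+ 2 + 4 * f ^+ 2 ->
    p2%:Z = g ^+ 2 + 4 * h ^+ 2 ->
    is_subfield F -> F 'i -> F (sqrtC (p1 * p2)%:R) ->
    2 * a = u%:~R -> 2 * b = v%:~R -> a ^+ 2 - (p1 * p2)%:R * b ^+ 2 = -1 ->
  exists (j : bool) (l : nat) (w : algC), F w /\
    (e%:~R + 2 * 'i * f%:~R) * (g%:~R + (-1) ^+ j * (2 * 'i * h%:~R)) *
      ('i ^+ l * (a + b * sqrtC (p1 * p2)%:R)) = w ^+ 2.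
Proof.
move=> pp1 pp2 p1E p2E sF Fi FP aE bE abE.
set sP := sqrtC _ in FP *; have sP2 : sP ^+ 2 = (p1 * p2)%:R by rewrite sqrtCK.
have i2 := sqrCi algC.
have n2 : 2 != 0 :> algC by rewrite pnatr_eq0.
have uvE : u ^+ 2 + 4 = (p1 * p2)%N%:Z * v ^+ 2.
  apply: (@intr_inj algC); rewrite intrD [RHS]intrM !rmorphXn /= -aE -bE -pmulrn.
  have -> : (2 * a) ^+ 2 + 4%:~R = 4 * (a ^+ 2 + 1) by ring.
  have -> : a ^+ 2 = (p1 * p2)%:R * b ^+ 2 - 1 by rewrite -abE; ring.
  by ring.
have [l [b1 [b2 [t [Gt tN0]]]]] := Gauss_square_class pp1 pp2 p1E p2E uvE.
set pi1 := e%:~R + _; set pi3 := g%:~R + _; set ui := u%:~R + _ => tE.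
pose pi4 : algC := g%:~R - 2 * 'i * h%:~R.
have Fa : F a.
  have -> : a = u%:~R / 2 by rewrite -aE mulrC mulKf.
  by subfield.
have Fb : F b.
  have -> : b = v%:~R / 2 by rewrite -bE mulrC mulKf.
  by subfield.
have Ft : F t.
  case: Gt => x [y [xQ yQ ->]].
  by subfield; [apply: (subfield_Crat sF xQ) | apply: (subfield_Crat sF yQ)].
have Fpi1 : F pi1 by rewrite /pi1; subfield.
have Fpi3 : F pi3 by rewrite /pi3; subfield.
have p2C : pi3 * pi4 = p2%:R.
  transitivity ((p2%:Z)%:~R : algC); last by rewrite -pmulrn.
  rewrite p2E intrD [X in _ + X]intrM !rmorphXn /=.
  transitivity (g%:~R ^+ 2 - 4 * h%:~R ^+ 2 * 'i ^+ 2 : algC); last by rewrite i2; ring.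
  by rewrite /pi3 /pi4; ring.
have p1N0 : p1%:R != 0 :> algC by rewrite pnatr_eq0 -lt0n prime_gt0.
have p2N0 : p2%:R != 0 :> algC by rewrite pnatr_eq0 -lt0n prime_gt0.
have pi3N0 : pi3 != 0 by apply: contraNneq p2N0 => E0; rewrite -p2C E0 mul0r.
have uiE : ui = 2 * (a + 'i) by rewrite /ui -aE; ring.
have uiN0 : ui != 0.
  apply: contraNneq tN0 => E0; move: tE; rewrite E0 !mul0r => /esym/eqP.
  by rewrite sqrf_eq0.
pose E := a + 'i + b * sP.
have epsE : ui * (a + b * sP) = E ^+ 2.
  rewrite uiE /E.
  have -> : (a + 'i + b * sP) ^+ 2 =
     a ^+ 2 + b ^+ 2 * sP ^+ 2 + 2 * a * 'i + 2 * a * b * sP + 2 * b * 'i * sP + 'i ^+ 2 by ring.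
  rewrite sP2 i2; have -> : (-1 : algC) = a ^+ 2 - (p1 * p2)%:R * b ^+ 2 by rewrite abE.
  by ring.
have FE : F E by rewrite /E; subfield.
have Fui : F ui by rewrite /ui; subfield.
have base : pi1 * pi3 * ('i ^+ l * p1%:R ^+ b1 * p2%:R ^+ b2 * (a + b * sP)) =
    (t * E / ui) ^+ 2.
  by rewrite expr_div_n exprMn -tE -epsE; field.
have FW : F (t * E / ui) by subfield.
have spN0 : sP != 0 by rewrite -sqrf_eq0 sP2 natrM mulf_neq0.
set W := t * E / ui in base FW.
have [b12|b12] := eqVneq b1 b2.
  exists false, l, (W / sP ^+ b1); split; first by subfield.
  rewrite expr0 mul1r -/pi3 expr_div_n -base -b12.
  have -> : (sP ^+ b1) ^+ 2 = p1%:R ^+ b1 * p2%:R ^+ b1.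
    by rewrite exprAC sP2 natrM exprMn.
  by field; rewrite !expf_neq0.
have pi4E : pi4 = p2%:R / pi3 by rewrite -p2C mulrC mulKf.
case: b1 b2 b12 base {tE} => -[] //= _; rewrite ?expr1 ?expr0 ?mulr1 => base.
  exists true, l, (W * p2%:R / (pi3 * sP)); split; first by subfield.
  rewrite expr_div_n exprMn -base exprMn sP2 natrM.
  rewrite expr1 mulN1r -/pi4 pi4E.
  by field; rewrite pi3N0 p1N0 p2N0.
exists true, l, (W / pi3); split; first by subfield.
rewrite expr_div_n -base expr1 mulN1r -/pi4 pi4E.
by field; exact: pi3N0.
Qed.

(** Ramification of pi: H is generated by pi and sqrt (p m), and the square of the latter is pi pi'
    m with pi' m prime to pi. Taking f in the integers covers the conjugate prime as well. *)
Lemma prime_above_square (p m : nat) (e f : int) (H : set algC)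
    (nu : {rmorphism algC -> algC}) :
    prime p -> odd p -> p%:Z = e ^+ 2 + 4 * f ^+ 2 -> coprime p m ->
    squarefree (p * m) -> nu (sqrtC (p * m)%:R) = - sqrtC (p * m)%:R ->
    prime_above (Qadjoin [set 'i]) (Qadjoin [set sqrtC (p * m)%:R; 'i])
      (e%:~R + 2 * 'i * f%:~R) H ->
  square_ideal (Qadjoin [set sqrtC (p * m)%:R; 'i]) H (e%:~R + 2 * 'i * f%:~R).
Proof.
move=> pp odd_p pE co_pm sfd nud; set sd := sqrtC _ in nud *.
set k := Qadjoin [set sd; _]; set Qi := Qadjoin [set 'i]; set pi := e%:~R + _.
move=> [[iH H1 Hprime] Hcap].
have i2 := sqrCi algC; have p_gt0 := prime_gt0 pp.
have sd2 : sd ^+ 2 = (p * m)%:R by rewrite sqrtCK.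
have sk : is_subfield k by apply: adjoin_subfield.
have sQi : is_subfield Qi by apply: adjoin_subfield.
have ki : k 'i by apply: adjoin_gen; right.
have kd : k sd by apply: adjoin_gen; left.
have Qik : Qi `<=` k.
  by apply: adjoin_min => // _ ->.
have iQi : Qi 'i by apply: adjoin_gen.
have iO : ringint Qi 'i by apply: ringint_sqr; rewrite // i2 rpredN rpred1.
have OiOk := ringint_sub Qik.
have OG (x y : int) : ringint Qi (x%:~R + y%:~R * 'i).
  by apply: ringintD => //; [|apply: ringintM => //]; apply: ringint_int.
have Opi : ringint Qi pi.
  have -> : pi = e%:~R + (2 * f)%:~R * 'i by rewrite /pi intrM; ring.
  exact: OG.
pose pi' : algC := e%:~R - 2 * 'i * f%:~R.
have Opi' : ringint Qi pi'.
  have -> : pi' = e%:~R + (- 2 * f)%:~R * 'i by rewrite /pi' intrM; ring.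
  exact: OG.
have piE : pi * pi' = p%:R.
  transitivity ((p%:Z)%:~R : algC); last by rewrite -pmulrn.
  rewrite pE intrD [X in _ + X]intrM !rmorphXn /=.
  transitivity (e%:~R ^+ 2 - 4 * f%:~R ^+ 2 * 'i ^+ 2 : algC); last by rewrite i2; ring.
  by rewrite /pi /pi'; ring.
have pN0 : p%:R != 0 :> algC by rewrite pnatr_eq0 -lt0n.
have piN0 : pi != 0 by apply: contraNneq pN0 => E0; rewrite -piE E0 mul0r.
have Hpi : H pi.
  have : scale pi (ringint Qi) pi by exists 1; rewrite ?mulr1 //; apply: ringint1.
  by rewrite -Hcap => -[].
have Od : ringint k sd.
  by apply: ringint_sqr; rewrite // sd2 (Aint_int (p * m)%N).
have Onat (n : nat) : ringint Qi n%:R by apply: ringint_nat.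
have Oint (n : int) : ringint Qi n%:~R by apply: ringint_int.
have sdE : sd * sd = pi' * m%:R * pi by rewrite -expr2 sd2 natrM -piE; ring.
have Hd : H sd.
  have : H (sd * sd).
    rewrite sdE; apply: (ideal_mul iH) => //; apply: OiOk.
    exact: ringintM.
  by case/Hprime.
have bezout (a b : int) : coprimez a b -> exists x y : int,
    x%:~R * a%:~R + y%:~R * b%:~R = 1 :> algC.
  by move=> /coprimezP[[x y] /= xy]; exists x, y; rewrite -!intrM -intrD xy.
have co2 : coprime 2 p by rewrite coprime2n.
(* An inverse of 4 modulo pi, to undo the denominators met in [Hgen]. *)
have [w [w' [Ow Ow' wE]]] : exists w w',
    [/\ ringint Qi w, ringint Qi w' & 4 * w + pi * w' = 1].
  have [|x [y xyE]] := bezout 4 p%:Z.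
    by have := coprimeXl 2 co2; rewrite coprimezE.
  exists x%:~R, (pi' * y%:~R); split=> //; first exact: ringintM.
  by rewrite mulrA piE -[RHS]xyE -!pmulrn; ring.
have e_cop : coprime p `|e|.
  rewrite prime_coprime //; apply/negP => /dvdn_leq pe.
  have pEn : p = (`|e| ^ 2 + 4 * `|f| ^ 2)%N.
    by apply/eqP; rewrite -eqz_nat PoszD PoszM -!abszX !abszE !ger0_norm ?sqr_ge0 // pE.
  have [e0|e_gt0] := posnP `|e|%N.
    by move: odd_p; rewrite pEn e0 exp0n // add0n oddM.
  by have := pe e_gt0; have := prime_gt1 pp; nia.
(* pi + pi' = 2e and pi pi' = p are coprime integers, so pi and pi' are comaximal. *)
have [x1 [y1 E1]] : exists x y : int, x%:~R * (pi + pi') + y%:~R * (pi * pi') = 1.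
  have [|x [y xyE]] := bezout (2 * e) p%:Z.
    by rewrite coprimezMl !coprimezE /= co2 coprime_sym.
  by exists x, y; rewrite piE -[RHS]xyE -pmulrn intrM /pi /pi'; ring.
have [x2 [y2 E2]] : exists x y : int, x%:~R * (pi * pi') + y%:~R * m%:R = 1.
  have [|x [y xyE]] := bezout p%:Z m%:Z; first by [].
  by exists x, y; rewrite piE -[RHS]xyE -!pmulrn.
have [al [be [Oal Obe abE]]] : exists al be,
    [/\ ringint Qi al, ringint Qi be & al * pi + be * (pi' * m%:R) = 1].
  exists ((x1%:~R + y1%:~R * pi') + x1%:~R * pi' * (x2%:~R * pi')), (x1%:~R * y2%:~R).
  split; try by repeat first [assumption | apply: Oint | apply: ringintD => // | apply: ringintM => //].
  transitivity (x1%:~R * pi + y1%:~R * (pi * pi') +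
    x1%:~R * pi' * (x2%:~R * (pi * pi') + y2%:~R * m%:R)); first by ring.
  by rewrite E2 -[RHS]E1; ring.
(* 4z = A + B [sd] with A, B in Z[i]: the parts of z under complex conjugation have coordinates in
   Q([sd]) with denominator at most 4. As [sd] is in H, so is A, and H meets Z[i] in the multiples
   of pi. *)
have Hgen z : H z -> exists a b, [/\ ringint k a, ringint k b & z = pi * a + sd * b].
  move=> Hz; have [kz Az] := ideal_int iH Hz.
  have Oz : ringint k z by [].
  have : quadext Gauss sd z.
    by rewrite -Qadjoin_sqrt2E // ?sd2 ?rpred_nat // i2 rpredN rpred1.
  move=> [_ [_ [[a1 [a2 [a1Q a2Q ->]]] [b1 [b2 [b1Q b2Q ->]]] zE]]].
  have sdR : sd^* = sd by apply/CrealP; rewrite ger0_real // sqrtC_ge0 ler0n.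
  have zcE : z^* = (a1 - a2 * 'i) + (b1 - b2 * 'i) * sd.
    by rewrite zE !(rmorphD, rmorphM) /= conjCi sdR !(conj_Crat a1Q, conj_Crat a2Q, conj_Crat b1Q, conj_Crat b2Q) !mulrN.
  have Azc : z^* \in Aint by rewrite (Aint_aut Num.conj).
  have dbl (a : algC) : a \in Crat -> 2 * a \in Crat by move=> aQ; rewrite rpredM // rpred_nat.
  have [X1 [Y1 [X1E Y1E]]] : exists X Y : int, 2 * (2 * a1) = X%:~R /\ 2 * (2 * b1) = Y%:~R.
    apply: (quad_coord_int sfd nud); try exact: dbl.
    have -> : 2 * a1 + 2 * b1 * sqrtC (p * m)%:R = z + z^* by rewrite zcE zE -/sd; ring.
    by rewrite rpredD.
  have [X2 [Y2 [X2E Y2E]]] : exists X Y : int, 2 * (2 * a2) = X%:~R /\ 2 * (2 * b2) = Y%:~R.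
    apply: (quad_coord_int sfd nud); try exact: dbl.
    have -> : 2 * a2 + 2 * b2 * sqrtC (p * m)%:R = - 'i * (z - z^*).
      rewrite zcE zE -/sd.
      transitivity (- (2 * a2 + 2 * b2 * sd) * 'i ^+ 2); last by ring.
      by rewrite i2; ring.
    by rewrite rpredM ?rpredB // rpredN; case: iO.
  pose A : algC := X1%:~R + X2%:~R * 'i; pose B : algC := Y1%:~R + Y2%:~R * 'i.
  have z4 : 4 * z = A + B * sd by rewrite /A /B -X1E -X2E -Y1E -Y2E zE; ring.
  have OA : ringint Qi A by apply: OG.
  have OB : ringint Qi B by apply: OG.
  have HA : H A.
    have -> : A = 4 * z + (- B) * sd by rewrite z4; ring.
    apply: (idealD iH); apply: (ideal_mul iH) => //; first exact: ringint_nat.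
    by apply: OiOk; rewrite -sub0r; apply: ringintB => //; apply: ringint0.
  have [A' OA' AE] : scale pi (ringint Qi) A by rewrite -Hcap.
  exists (A' * w + z * w'), (B * w); split.
  - by apply: ringintD => //; apply: ringintM => //; apply: OiOk.
  - by apply: ringintM => //; apply: OiOk.
  - have -> : pi * (A' * w + z * w') + sd * (B * w) =
      (pi * A' + B * sd) * w + z * (pi * w') by ring.
    rewrite AE -z4; transitivity (z * (4 * w + pi * w')); last by ring.
    by rewrite wE mulr1.
split=> //; first exact: OiOk.
apply/seteqP; split.
  apply: idealM_min => [|_ _ [x Ox <-] [y Oy <-]|x y /Hgen[a [b [Oa Ob ->]]] /Hgen[c [b' [Oc Ob' ->]]]].
  - by exists 0; rewrite ?mulr0 //; apply: ringint0.
  - by rewrite -mulrDr; apply: scale_mem; apply: ringintD.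
  - exists (pi * a * c + sd * (a * b' + b * c) + pi' * m%:R * (b * b')).
      have Opik := OiOk _ Opi; have Opik' := OiOk _ Opi'; have Omk := OiOk _ (Onat m).
      by repeat first [assumption | apply: ringintD => // | apply: ringintM => //].
    transitivity (pi * (pi * a * c) + pi * sd * (a * b' + b * c) + (pi' * m%:R * pi) * (b * b')); first by ring.
    by rewrite -sdE; ring.
have H2 : is_ideal k (idealM H H) by apply: idealM_ideal.
move=> _ [x Ox <-]; rewrite mulrC; apply: (ideal_mul H2) => //.
have -> : pi = al * (pi * pi) + be * (sd * sd).
  transitivity ((al * pi + be * (pi' * m%:R)) * pi); first by rewrite abE mul1r.
  by rewrite sdE; ring.
by apply: (idealD H2); apply: (ideal_mul H2); try exact: idealM_mem; apply: OiOk.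
Qed.

(** If c' (x + 1) or c' (x - 1) is a square, then 2 c' u is a square in k. Both alternatives lead to
    c: for c' = c the factor 2 is i^3 times a square, and for c' = 2c it becomes 4. *)
Lemma square_pm1_unit (d : nat) (x y c : int) (k : set algC) :
    is_subfield k -> k 'i -> k (sqrtC d%:R) ->
    x ^+ 2 - d%:Z * y ^+ 2 = 1 -> y != 0 -> (0 < d)%N -> c != 0 ->
    is_unit k (x%:~R + y%:~R * sqrtC d%:R) ->
    is_square_pm1 c x \/ is_square_pm1 (2 * c) x ->
  exists u b, [/\ is_unit k u, k b & c%:~R * u = b ^+ 2].
Proof.
move=> sk ki kd xy1 yN0 d_gt0 cN0; set s := sqrtC _ in kd *; set u := x%:~R + _ => uU.
have s2 : s ^+ 2 = d%:R by rewrite sqrtCK.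
have [Ou uN0 OuV] := uU; have i2 := sqrCi algC.
have step (c' : int) : c' != 0 -> is_square_pm1 c' x -> exists2 b, k b & 2 * c'%:~R * u = b ^+ 2.
  move=> c'N0 [n nE].
  have [sg [sgE {}nE]] : exists sg : int, sg ^+ 2 = 1 /\ c' * (x + sg) = n%:Z ^+ 2.
    by case: nE => nE; [exists 1 | exists (-1)].
  have nN0 : n%:R != 0 :> algC.
    rewrite pnatr_eq0; apply: contraNneq yN0 => n0.
    move/eqP: nE; rewrite n0 expr0n mulf_eq0 (negPf c'N0) addr_eq0 => /eqP xE.
    move/eqP: xy1; rewrite xE sqrrN sgE subr_eq addrC -subr_eq subrr eq_sym.
    by rewrite mulf_eq0 sqrf_eq0 eqz_nat (gtn_eqF d_gt0).
  exists (c'%:~R * (x%:~R + sg%:~R + y%:~R * s) / n%:R); first by subfield.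
  have nEC : c'%:~R * (x%:~R + sg%:~R) = n%:R ^+ 2 :> algC.
    by rewrite -rmorphD -rmorphM /= nE rmorphXn.
  have key : (x%:~R + sg%:~R + y%:~R * s) ^+ 2 = 2 * (x%:~R + sg%:~R) * u.
    have sgC : sg%:~R ^+ 2 = 1 :> algC by rewrite -rmorphXn /= sgE.
    have xyC : x%:~R ^+ 2 - d%:R * y%:~R ^+ 2 = 1 :> algC.
      have := congr1 (fun n : int => n%:~R : algC) xy1.
      by rewrite rmorphB /= [X in _ - X]intrM !rmorphXn /= -pmulrn.
    have -> : (x%:~R + sg%:~R + y%:~R * s) ^+ 2 = x%:~R ^+ 2 + sg%:~R ^+ 2 +
      y%:~R ^+ 2 * s ^+ 2 + 2 * x%:~R * sg%:~R + 2 * (x%:~R + sg%:~R) * y%:~R * s by ring.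
    have yC : y%:~R ^+ 2 * d%:R = x%:~R ^+ 2 - 1 :> algC.
      by rewrite -[X in _ - X]xyC; ring.
    by rewrite sgC s2 yC /u; ring.
  have : c'%:~R * (x%:~R + sg%:~R) != 0 :> algC by rewrite nEC expf_neq0.
  rewrite mulf_eq0 negb_or => /andP[? ?].
  by rewrite expr_div_n exprMn key -nEC; field; apply/andP.
have n2 : 2 != 0 :> algC by rewrite pnatr_eq0.
case=> [/(step _ cN0)|/step[|b kb bE]].
- move=> [b kb bE]; exists ('i ^+ 3 * u), (b / (1 + 'i)); split; last first.
  + rewrite expr_div_n -bE [X in X * _ * _]two_eq_i3_sqr; field; exact: Ci1_neq0.
  + by subfield.
  + have iA : 'i \in Aint by apply: Aint_sqr; rewrite i2 rpredN rpred1.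
    case: Ou OuV => ku Au [kuV AuV].
    split; first by split; [subfield | rewrite rpredM ?rpredX].
      by rewrite mulf_neq0 ?expf_neq0 ?neq0Ci.
    split; first by subfield.
    by rewrite invfM -exprVn invCi rpredM ?rpredX ?rpredN.
- by rewrite mulf_neq0.
- exists u, (b / 2); split=> //; first by subfield.
  by rewrite expr_div_n -bE intrM; field.
Qed.

(** * Squares up to units *)

(** For a generator a of the square of an ideal, this makes the ideal principal. *)
Definition square_mod_unit (F : set algC) (a : algC) : Prop :=
  exists u b, [/\ is_unit F u, F b & a * u = b ^+ 2].

Lemma is_unit1 F : is_subfield F -> is_unit F 1.
Proof. by move=> sF; split; rewrite ?invr1 ?oner_neq0 //; apply: ringint1. Qed.

Lemma is_unitM F (u v : algC) : is_subfield F ->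
  is_unit F u -> is_unit F v -> is_unit F (u * v).
Proof.
move=> sF [Ou uN0 OuV] [Ov vN0 OvV].
by split; rewrite ?invfM ?mulf_neq0 //; apply: ringintM.
Qed.

Lemma is_unitV F (u : algC) : is_unit F u -> is_unit F u^-1.
Proof. by move=> [Ou uN0 OuV]; split; rewrite ?invrK ?invr_neq0. Qed.

Lemma is_unitX F (u : algC) n : is_subfield F -> is_unit F u -> is_unit F (u ^+ n).
Proof.
move=> sF uU; elim: n => [|n IHn]; first by rewrite expr0; apply: is_unit1.
by rewrite exprS; apply: is_unitM.
Qed.

Lemma is_unit_sub (F K : set algC) u : F `<=` K -> is_unit F u -> is_unit K u.
Proof. by move=> FK [Ou uN0 OuV]; split=> //; apply: (ringint_sub FK). Qed.

Lemma is_unit_i F : is_subfield F -> F 'i -> is_unit F 'i.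
Proof.
move=> sF Fi; have iA : 'i \in Aint by apply: Aint_sqr; rewrite sqrCi rpredN rpred1.
split; [by split | exact: neq0Ci |].
by rewrite invCi; split; [subfield | rewrite rpredN].
Qed.

Lemma square_mod_unit_sqr F (a : algC) :
  is_subfield F -> F a -> square_mod_unit F (a ^+ 2).
Proof. by move=> sF Fa; exists 1, a; split; rewrite ?mulr1 //; apply: is_unit1. Qed.

Lemma square_mod_unitM F (a b : algC) : is_subfield F ->
  square_mod_unit F a -> square_mod_unit F b -> square_mod_unit F (a * b).
Proof.
move=> sF [u [x [uU Fx xE]]] [v [y [vU Fy yE]]].
exists (u * v), (x * y); split; [exact: is_unitM | by subfield |].
by rewrite exprMn -xE -yE; ring.
Qed.

Lemma square_mod_unit_cancel F (a b : algC) : is_subfield F -> a != 0 ->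
  square_mod_unit F (a * b) -> square_mod_unit F a -> square_mod_unit F b.
Proof.
move=> sF aN0 [u [x [uU Fx xE]]] [v [y [vU Fy yE]]].
exists (u / v), (x / y); split; [|by subfield|].
  by apply: is_unitM => //; apply: is_unitV.
have vN0 : v != 0 by case: vU.
by rewrite expr_div_n -xE -yE; field; rewrite aN0 vN0.
Qed.

Lemma square_mod_unit_sub (F K : set algC) a :
  F `<=` K -> square_mod_unit F a -> square_mod_unit K a.
Proof.
by move=> FK [u [b [uU Fb abE]]]; exists u, b; split=> //; [apply: is_unit_sub uU | apply: FK].
Qed.

Lemma ideal_class_square_mod_unit F I J (a b : algC) : is_subfield F ->
    square_ideal F I a -> square_ideal F J b -> square_mod_unit F (a * b) ->
  ideal_class F I = ideal_class F J.
Proof.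
move=> sF aI bJ [u [w [uU Fw wE]]].
have [_ Oa aN0 _] := aI; have [_ Ob bN0 _] := bJ; have [Ou uN0 _] := uU.
have wN0 : w != 0 by rewrite -sqrf_eq0 -wE !mulf_neq0.
apply: (ideal_class_square (s := b) (t := w) sF aI bJ uU) => //.
  apply: ringint_sqr => //; rewrite -wE.
  by case: (ringintM sF (ringintM sF Oa Ob) Ou).
by rewrite -wE; ring.
Qed.

Section SubgroupMembership.

Variables (F : set algC) (G : set (set (set algC))).
Hypotheses (sF : is_subfield F) (sG : is_Cl_subgroup F G).

(** The ideal is determined by [a], so membership of its class in G becomes a multiplicative
    property of numbers. *)
Definition in_subgroup (a : algC) : Prop :=
  exists2 I, square_ideal F I a & G (ideal_class F I).

Lemma in_subgroup1 : in_subgroup 1.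
Proof. by exists (ringint F); [apply: square_ideal1 | case: sG]. Qed.

Lemma in_subgroupM a b : in_subgroup a -> in_subgroup b -> in_subgroup (a * b).
Proof.
move=> [I aI GI] [J bJ GJ]; exists (idealM I J); first exact: square_idealM.
rewrite -(classM_ideal_class sF (square_ideal_nz sF aI) (square_ideal_nz sF bJ)).
by case: sG => _ _ GM _; apply: GM.
Qed.

Lemma in_subgroup_class a b I : in_subgroup a -> square_ideal F I b ->
  square_mod_unit F (a * b) -> G (ideal_class F I).
Proof.
by move=> [J aJ GJ] bI ab; rewrite -(ideal_class_square_mod_unit sF aJ bI ab).
Qed.

End SubgroupMembership.

(** * The capitulation kernel in the four cases *)

Theorem theorem5p7
  (p1 p2 q : nat) (pp1 : prime p1) (pp2 : prime p2) (pq : prime q)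
  (distinct : uniq [:: p1; p2; q])
  (p1mod4 : (p1%:Z = 1 %[mod 4])%Z)
  (p2mod4 : (p2%:Z = 1 %[mod 4])%Z)
  (qmod4 : (- q%:Z = 1 %[mod 4])%Z)
  (k : set algC) (kE : k = Qadjoin [set sqrtC (p1 * p2 * q)%:R; 'i])
  (K3 : set algC) (K3E : K3 = adjoin k [set sqrtC q%:R])
  (x y : int)
  (eps_p1p2q : is_fundamental_unit (p1 * p2 * q)
                 (x%:~R + y%:~R * sqrtC (p1 * p2 * q)%:R))
  (eps : algC) (eps_p1p2 : is_fundamental_unit (p1 * p2) eps)
  (norm_eps : has_quad_norm (p1 * p2) eps (-1))
  (e f g h : nat)
  (p1E : p1 = (e ^ 2 + 4 * f ^ 2)%N) (p2E : p2 = (g ^ 2 + 4 * h ^ 2)%N)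
  (H1 H2 H3 H4 : set algC)
  (H1P : prime_above (Qadjoin [set 'i]) k (e%:R + 2 * 'i * f%:R) H1)
  (H2P : prime_above (Qadjoin [set 'i]) k (e%:R - 2 * 'i * f%:R) H2)
  (H3P : prime_above (Qadjoin [set 'i]) k (g%:R + 2 * 'i * h%:R) H3)
  (H4P : prime_above (Qadjoin [set 'i]) k (g%:R - 2 * 'i * h%:R) H4) :
  [/\ (is_square_pm1 q%:Z x \/ is_square_pm1 (2 * q%:Z) x ->
         capitulation k K3 = Cl_gen k [set ideal_class k (idealM H1 H3)] \/
         capitulation k K3 = Cl_gen k [set ideal_class k (idealM H1 H4)]),
      (is_square_pm1 1 x ->
         capitulation k K3 =
           Cl_gen k [set ideal_class k (idealM H1 H3);
                         ideal_class k (idealM H2 H4)] \/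
         capitulation k K3 =
           Cl_gen k [set ideal_class k (idealM H1 H4);
                         ideal_class k (idealM H2 H3)]),
      (is_square_pm1 p1%:Z x \/ is_square_pm1 (2 * p1%:Z) x ->
         capitulation k K3 =
           Cl_gen k [set ideal_class k (idealM H1 H3);
                         ideal_class k (idealM H1 H4)]) &
      (is_square_pm1 p2%:Z x \/ is_square_pm1 (2 * p2%:Z) x ->
         capitulation k K3 =
           Cl_gen k [set ideal_class k (idealM H1 H3);
                         ideal_class k (idealM H2 H3)])].
Proof.
move: distinct; rewrite /= !inE negb_or andbT => /andP[/andP[p12 p1q] p2q].
have m1 : (p1 %% 4 = 1)%N by lia.
have m2 : (p2 %% 4 = 1)%N by lia.
have mq : (q %% 4 = 3)%N by lia.
have odd1 : odd p1 by lia. have odd2 : odd p2 by lia. have oddq : odd q by lia.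
have [r1 p1E4] : exists r, p1 = (4 * r + 1)%N by exists (p1 %/ 4)%N; lia.
have [r2 p2E4] : exists r, p2 = (4 * r + 1)%N by exists (p2 %/ 4)%N; lia.
have [rq qE4] : exists r, q = (4 * r + 3)%N by exists (q %/ 4)%N; lia.
have [md dE4] : exists md : int, (p1 * p2 * q)%N%:Z = 4 * md + 3.
  exists (Posz ((4 * r1 + 1) * (4 * r2 + 1) * rq + 3 * (4 * r1 * r2 + r1 + r2))%N).
  by rewrite p1E4 p2E4 qE4; lia.
have p1_gt1 := prime_gt1 pp1; have p2_gt1 := prime_gt1 pp2; have q_gt1 := prime_gt1 pq.
set P := (p1 * p2)%N in eps_p1p2 norm_eps *.
have P_gt1 : (1 < P)%N by apply: ltn_mul p1_gt1 p2_gt1.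
have n12 : 2%N != p1 by lia. have n22 : 2%N != p2 by lia. have nq2 : 2%N != q by lia.
have sf (s : seq nat) m : all prime s -> uniq s -> m = (\prod_(p <- s) p)%N -> squarefree m.
  by move=> sp su ->; apply: squarefree_prod.
have sfq : squarefree q by apply: (sf [:: q]); rewrite ?big_cons ?big_nil ?muln1 //= pq.
have sfP : squarefree P.
  by apply: (sf [:: p1; p2]); rewrite ?big_cons ?big_nil ?muln1 //= ?inE ?pp1 ?pp2 ?p12.
have sfd : squarefree (P * q).
  apply: (sf [:: p1; p2; q]); rewrite ?big_cons ?big_nil ?muln1 ?mulnA //=.
    by rewrite pp1 pp2 pq.
  by rewrite !inE negb_or p12 p1q p2q.
have sf2 : squarefree 2 by apply: (sf [:: 2%N]); rewrite ?big_cons ?big_nil.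
have sf2q : squarefree (2 * q).
  by apply: (sf [:: 2%N; q]); rewrite ?big_cons ?big_nil ?muln1 //= ?inE ?pq ?nq2.
have sf2P : squarefree (2 * P).
  apply: (sf [:: 2%N; p1; p2]); rewrite ?big_cons ?big_nil ?muln1 ?mulnA //=.
    by rewrite pp1 pp2.
  by rewrite !inE negb_or p12 n12 n22.
have sf2d : squarefree (2 * (P * q)).
  apply: (sf [:: 2%N; p1; p2; q]); rewrite ?big_cons ?big_nil ?muln1 ?mulnA //=.
    by rewrite pp1 pp2 pq.
  by rewrite !inE !negb_or p12 p1q p2q n12 n22 nq2.
have sfqP : squarefree (q * P) by rewrite mulnC.
have [tau1 [tau1i tau1q tau1P]] := exists_aut_sqrtC sfq sfP sfqP q_gt1 P_gt1.
have [tau2 [tau2i tau2P tau2q]] := exists_aut_sqrtC sfP sfq sfd P_gt1 q_gt1.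
pose sg : {rmorphism algC -> algC} := (tau1 \o tau2)%FUN.
set sd := sqrtC (p1 * p2 * q)%:R in kE eps_p1p2q.
set sq := sqrtC q%:R in K3E tau1q tau2q.
pose sP : algC := sqrtC P%:R.
have sdE : sd = sP * sq by apply: sqrtCM_natE.
have tau1d : tau1 sd = - sd by rewrite sdE rmorphM tau1P tau1q mulNr.
have i2 := sqrCi algC.
have sk : is_subfield k by rewrite kE; apply: adjoin_subfield.
have sK : is_subfield K3 by rewrite K3E; apply: adjoin_subfield.
have kK : k `<=` K3 by rewrite K3E; apply: adjoin_base.
have ki : k 'i by rewrite kE; apply: adjoin_gen; right.
have kd : k sd by rewrite kE; apply: adjoin_gen; left.
have Ki := kK _ ki.
have Kq : K3 sq by rewrite K3E; apply: adjoin_gen.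
have KP : K3 sP by rewrite K3E kE; apply: octic_sP.
have sP2 : sP ^+ 2 = P%:R by rewrite sqrtCK.
have sq2 : sq ^+ 2 = q%:R by rewrite sqrtCK.
have sd2 : sd ^+ 2 = P%:R * q%:R by rewrite sqrtCK -natrM.
set pi1 := _ + _ in H1P; set pi2 := _ - _ in H2P.
set pi3 := _ + _ in H3P; set pi4 := _ - _ in H4P.
have p1EZ : p1%:Z = e%:Z ^+ 2 + 4 * f%:Z ^+ 2 by rewrite p1E; lia.
have p2EZ : p2%:Z = g%:Z ^+ 2 + 4 * h%:Z ^+ 2 by rewrite p2E; lia.
have co1 : coprime p1 (p2 * q).
  by rewrite coprimeMr !prime_coprime // !dvdn_prime2 // p12 p1q.
have co2 : coprime p2 (p1 * q).
  by rewrite coprimeMr !prime_coprime // !dvdn_prime2 // eq_sym p12 p2q.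
have d1E : (p1 * (p2 * q) = p1 * p2 * q)%N by rewrite mulnA.
have d2E : (p2 * (p1 * q) = p1 * p2 * q)%N by rewrite mulnCA mulnA.
have sq1 (a b : int) H : p1%:Z = a ^+ 2 + 4 * b ^+ 2 ->
    prime_above (Qadjoin [set 'i]) k (a%:~R + 2 * 'i * b%:~R) H ->
    square_ideal k H (a%:~R + 2 * 'i * b%:~R).
  move=> abE; have := @prime_above_square p1 (p2 * q) a b H tau1 pp1 odd1 abE co1.
  by rewrite d1E -/sd -kE; apply.
have sq2' (a b : int) H : p2%:Z = a ^+ 2 + 4 * b ^+ 2 ->
    prime_above (Qadjoin [set 'i]) k (a%:~R + 2 * 'i * b%:~R) H ->
    square_ideal k H (a%:~R + 2 * 'i * b%:~R).
  move=> abE; have := @prime_above_square p2 (p1 * q) a b H tau1 pp2 odd2 abE co2.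
  by rewrite d2E -/sd -kE; apply.
have S1 : square_ideal k H1 pi1 by apply: (sq1 e f).
have S3 : square_ideal k H3 pi3 by apply: (sq2' g h).
have S2 : square_ideal k H2 pi2.
  have pi2E : pi2 = e%:~R + 2 * 'i * (- f%:Z)%:~R.
    by rewrite mulrNz mulrN.
  by rewrite pi2E; apply: sq1; rewrite ?sqrrN // -pi2E.
have S4 : square_ideal k H4 pi4.
  have pi4E : pi4 = g%:~R + 2 * 'i * (- h%:Z)%:~R.
    by rewrite mulrNz mulrN.
  by rewrite pi4E; apply: sq2'; rewrite ?sqrrN // -pi4E.
have p1C : pi1 * pi2 = p1%:R.
  rewrite p1E natrD natrM !natrX.
  transitivity (e%:R ^+ 2 - 4 * f%:R ^+ 2 * 'i ^+ 2 : algC); last by rewrite i2; ring.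
  by rewrite /pi1 /pi2; ring.
have p2C : pi3 * pi4 = p2%:R.
  rewrite p2E natrD natrM !natrX.
  transitivity (g%:R ^+ 2 - 4 * h%:R ^+ 2 * 'i ^+ 2 : algC); last by rewrite i2; ring.
  by rewrite /pi3 /pi4; ring.
have kpi (a b : nat) : k (a%:R + 2 * 'i * b%:R) /\ k (a%:R - 2 * 'i * b%:R).
  by split; subfield.
have [kpi1 kpi2] := kpi e f; have [kpi3 kpi4] := kpi g h.
have pi1N0 : pi1 != 0 by case: S1. have pi2N0 : pi2 != 0 by case: S2.
have pi3N0 : pi3 != 0 by case: S3. have pi4N0 : pi4 != 0 by case: S4.
have [a [b [epsE abE]]] := norm_eps.
have aQ := Crat_rat a; have bQ := Crat_rat b.
have epsA : eps \in Aint by case: eps_p1p2 => -[[]].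
have abC : (ratr a : algC) ^+ 2 - P%:R * ratr b ^+ 2 = -1.
  have := congr1 (ratr : rat -> algC) abE.
  by rewrite rmorphN1 rmorphB [X in _ - X]rmorphM !rmorphXn /= ratr_nat => <-.
have tau1E (c d : algC) : c \in Crat -> d \in Crat -> tau1 (c + d * sP) = c - d * sP.
  move=> cQ dQ; rewrite rmorphD [tau1 (_ * _)]rmorphM tau1P mulrN.
  by rewrite (aut_Crat _ cQ) (aut_Crat _ dQ).
have eps_norm : eps * tau1 eps = -1.
  by rewrite epsE -/sP tau1E // -[RHS]abC -[in RHS]sP2; ring.
have [|u [v [uE vE]]] := quad_coord_int sfP tau1P aQ bQ; first by rewrite -epsE.
have [j [l [w [Kw wE]]]] := @eps_square_class p1 p2 e f g h u v K3 _ _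
  pp1 pp2 p1EZ p2EZ sK Ki KP uE vE abC.
(* [j] comes from eps_P, and H1 Hj is the product whose class capitulates because of [KA]. *)
pose pij : algC := if j then pi4 else pi3; pose Hj := if j then H4 else H3.
have Sj : square_ideal k Hj pij by rewrite /Hj /pij; case: (j).
have kpij : k pij by rewrite /pij; case: (j).
pose A := pi1 * pij.
have kA : k A by rewrite /A; subfield.
have SA : square_ideal k (idealM H1 Hj) A by apply: square_idealM.
have AN0 : A != 0 by case: SA.
have PE : P%:R = pi1 * pi2 * (pi3 * pi4) by rewrite p1C p2C -natrM.
have epsU : is_unit K3 eps.
  by have [uU _ _] := eps_p1p2; apply: is_unit_sub uU; apply: adjoin_min => // _ ->.
have KA : square_mod_unit K3 A.
  exists ('i ^+ l * eps), w; split=> //.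
    by apply: is_unitM => //; apply: is_unitX => //; apply: is_unit_i.
  rewrite -wE epsE; congr (_ * _ * _); rewrite /pij; case: (j).
    by rewrite expr1 mulN1r.
  by rewrite expr0 mul1r.
have K_P : square_mod_unit K3 P%:R.
  by rewrite -sP2; apply: square_mod_unit_sqr.
have fixk z : k z -> sg z = z by rewrite kE; apply: quartic_fix.
have fixK z : K3 z -> sg z = z -> k z by rewrite K3E kE; apply: octic_fixed.
have KK z : K3 z -> K3 (sg z).
  rewrite K3E kE; apply: octic_aut; rewrite /= -kE -K3E ?tau2i ?tau1i ?tau2P ?tau1P //.
    by rewrite tau2q rmorphN tau1q; subfield.
  by subfield.
have sgK z : K3 z -> sg (sg z) = z by rewrite K3E kE; apply: octic_involution.
have unitK eta : is_unit K3 eta -> eta * sg eta = 1 -> exists (l : nat) (d : bool) s,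
    [/\ K3 s, s != 0 & eta = 'i ^+ l * eps ^+ d * s ^+ 2].
  by rewrite K3E kE; apply: octic_unit_square.
have epsN0 : eps != 0 by case: epsU.
have sqN0 : sq != 0 by rewrite sqrtC_eq0 pnatr_eq0 -lt0n ltnW.
have sPN0 : sP != 0 by rewrite sqrtC_eq0 pnatr_eq0 -lt0n ltnW.
have sdN0 : sd != 0 by rewrite sdE mulf_neq0.
have unit_i := is_unit_i sk ki.
have capP I : is_nzideal k I -> capitulation k K3 (ideal_class k I) ->
    exists c (d1 d2 : bool), square_ideal k I c /\
      square_mod_unit k (A ^+ d1 * P%:R ^+ d2 * c).
  move=> nI /(capitulation_norm sk sK kK fixk KK sgK fixK nI)[al [Kal alN0 etaU Sal]].
  have sgalN0 : sg al != 0 by rewrite fmorph_eq0.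
  have [|m [d1 [s [Ks sN0 etaE]]]] := unitK _ etaU.
    by rewrite fmorph_div sgK //; field; rewrite alN0 sgalN0.
  (* Chosen so that the factor eps^d1 of al^2 cancels against the one in w^2, leaving A^d1 times the
     norm of [al] and a power of i. *)
  pose W := al * w ^+ d1 / (s * eps ^+ d1).
  have Keps : K3 eps by case: epsU => -[].
  have KW : K3 W by rewrite /W; subfield.
  have WE : W ^+ 2 = A ^+ d1 * (al * sg al) * ('i ^+ (m + l * d1)).
    have al2 : al ^+ 2 = al * sg al * ('i ^+ m * eps ^+ d1 * s ^+ 2).
      by rewrite -etaE; field.
    have w2 : (w ^+ d1) ^+ 2 = A ^+ d1 * (('i ^+ l) ^+ d1 * eps ^+ d1).
      rewrite -!exprMn exprAC -wE epsE /A /pij.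
      congr (_ ^+ _); congr (_ * _ * _); case: (j); first by rewrite expr1 mulN1r.
      by rewrite expr0 mul1r.
    rewrite /W expr_div_n exprMn al2 w2 exprD exprM exprMn.
    by field; rewrite sN0 expf_neq0.
  clearbody W; have [kc _] : ringint k (al * sg al) by case: Sal.
  have kW2 : k (W ^+ 2) by rewrite WE; subfield.
  have unitm := is_unitX (m + l * d1) sk unit_i.
  have /eqP : sg W ^+ 2 = W ^+ 2 by rewrite -rmorphXn fixk.
  rewrite eqf_sqr => /orP[]/eqP sgW; exists (al * sg al), d1.
    exists false; split=> //; exists ('i ^+ (m + l * d1)), W; split=> //.
      exact: fixK.
    by rewrite expr0 mulr1 WE.
  exists true; split=> //.
  have kWq : k (W * sq).
    apply: fixK; first by subfield.
    by rewrite rmorphM sgW /= tau2q rmorphN tau1q mulrNN.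
  (* This is W sqrt P, written so that it visibly lies in k. *)
  exists ('i ^+ (m + l * d1)), (W * sq * P%:R / sd); split=> //.
    by subfield.
  have P0 : P%:R != 0 :> algC by rewrite -sP2 expf_neq0.
  have q0 : q%:R != 0 :> algC by rewrite -sq2 expf_neq0.
  rewrite expr_div_n.
  have -> : (W * sq * P%:R) ^+ 2 = W ^+ 2 * sq ^+ 2 * P%:R ^+ 2 by ring.
  rewrite [P%:R ^+ true]expr1 WE sq2 sd2.
  move: ('i ^+ _) (A ^+ _) (P%:R : algC) (q%:R : algC) P0 q0 => i0 A0 P1 q1 P0 q0.
  by field; rewrite P0 q0.
(* By [capP] the kernel is reached from A and P, so two checks remain per case: each generator
   capitulates, and A and P belong to every subgroup containing S. *)
have main (S : set (set (set algC))) :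
    (forall C, S C -> exists J c, [/\ C = ideal_class k J, square_ideal k J c & square_mod_unit K3 c]) ->
    (forall G, is_Cl_subgroup k G -> S `<=` G -> in_subgroup k G A /\ in_subgroup k G P%:R) ->
    capitulation k K3 = Cl_gen k S.
  move=> Scap SG; apply/seteqP; split; last first.
    apply: Cl_genP; first exact: capitulation_subgroup.
    move=> _ /Scap[J [c [-> cJ [u' [b' [uU Kb' cE]]]]]].
    exact: (capitulation_square sk sK kK cJ uU Kb').
  move=> C CC; have [[I nI CE] _] := CC; rewrite CE in CC *.
  have [c [d1 [d2 [Sc smu]]]] := capP _ nI CC.
  move=> G [sG /(SG _ sG)[GA GP]].
  apply: (in_subgroup_class sk _ Sc smu); apply: in_subgroupM => //.
    by case: (d1) => //; apply: in_subgroup1.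
  by case: (d2) => //; apply: in_subgroup1.
have epsdU : is_unit k (x%:~R + y%:~R * sd).
  by have [uU _ _] := eps_p1p2q; apply: is_unit_sub uU; apply: adjoin_min => // _ ->.
have [[_ dA] dN0 [_ dVA]] := epsdU.
(* Norm -1 is impossible because d is 3 modulo 4. *)
have xy1 : x ^+ 2 - (p1 * p2 * q)%N%:Z * y ^+ 2 = 1.
  have inj (c : int) : x%:~R ^+ 2 - (p1 * p2 * q)%:R * y%:~R ^+ 2 = c%:~R :> algC ->
      x ^+ 2 - (p1 * p2 * q)%N%:Z * y ^+ 2 = c.
    move=> E; apply: (@intr_inj algC); rewrite -E rmorphB /= [X in _ - X]intrM.
    by rewrite !rmorphXn /= -pmulrn.
  have xQ (n : int) : n%:~R \in Crat by rewrite rpred_int.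
  have [/(inj 1)//|] := quad_unit_norm tau1d (xQ x) (xQ y) dA dVA dN0.
  rewrite -(mulrN1z 1) => /inj; rewrite dE4 !expr2 => E.
  by case: (sqr_sub_neqN1 E).
have yN0 : y != 0.
  apply/eqP => y0; have [_ e_gt1 _] := eps_p1p2q.
  move: xy1; rewrite y0 expr0n mulr0 subr0 => /eqP; rewrite sqrf_eq1 => /orP[]/eqP x1;
    move: e_gt1; rewrite y0 mul0r addr0 x1 ?mulrN1z ?ltxx //.
  by move=> lt1; have := lt_trans lt1 (ltrN10 _); rewrite ltr10.
have sq_unit (c : int) : c != 0 -> is_square_pm1 c x \/ is_square_pm1 (2 * c) x ->
    square_mod_unit k c%:~R.
  move=> cN0 cx; have [|u' [b' H']] := square_pm1_unit sk ki kd xy1 yN0 _ cN0 epsdU cx.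
    by rewrite !muln_gt0 !prime_gt0.
  by exists u', b'.
have natN0 (p : nat) : prime p -> p%:Z != 0 by move=> pp; rewrite eqz_nat -lt0n prime_gt0.
have natCN0 (p : nat) : prime p -> p%:R != 0 :> algC by move=> pp; rewrite pnatr_eq0 -lt0n prime_gt0.
have inG G J c : square_ideal k J c -> G (ideal_class k J) -> in_subgroup k G c by exists J.
have S13 := square_idealM sk S1 S3; have S14 := square_idealM sk S1 S4.
have S24 := square_idealM sk S2 S4; have S23 := square_idealM sk S2 S3.
have SP : square_ideal k (idealM (idealM H1 H3) (idealM H2 H4)) P%:R.
  have -> : P%:R = (pi1 * pi3) * (pi2 * pi4) by rewrite PE; ring.
  exact: square_idealM.
have inP G c : is_Cl_subgroup k G -> in_subgroup k G c -> square_mod_unit k (c * P%:R) ->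
    in_subgroup k G P%:R.
  by move=> sG Gc cP; apply: (inG _ _ _ SP); apply: (in_subgroup_class sk Gc SP cP).
have sqrk c : k c -> square_mod_unit k (c ^+ 2) by apply: square_mod_unit_sqr.
have sqrK c : K3 c -> square_mod_unit K3 (c ^+ 2) by apply: square_mod_unit_sqr.
split.
- move=> /(sq_unit _ (natN0 _ pq)) kq.
  suff capE : capitulation k K3 = Cl_gen k [set ideal_class k (idealM H1 Hj)].
    by move: capE; rewrite /Hj; case: (j); [right | left].
  apply: main => [_ ->|G sG SG]; first by exists (idealM H1 Hj), A.
  split; first by apply: (inG _ _ _ SA); apply: SG.
  (* q and q P = d are squares up to units of k, hence so is P, and [H1 H2 H3 H4] is trivial. *)
  apply: (inP _ _ sG (in_subgroup1 sk sG)); rewrite mul1r.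
  apply: (square_mod_unit_cancel sk (natCN0 _ pq)) kq.
  by rewrite mulrC -sd2; apply: sqrk.
- move=> _; pose pik : algC := if j then pi3 else pi4; pose Hk := if j then H3 else H4.
  have Sk : square_ideal k Hk pik by rewrite /Hk /pik; case: (j).
  have S2k := square_idealM sk S2 Sk.
  (* P is a square in K3, so the complementary product pi2 pik becomes a square up to a unit
     together with A. *)
  have PE' : P%:R = A * (pi2 * pik) by rewrite PE /A /pij /pik; case: (j); ring.
  suff capE : capitulation k K3 =
      Cl_gen k [set ideal_class k (idealM H1 Hj); ideal_class k (idealM H2 Hk)].
    by move: capE; rewrite /Hj /Hk; case: (j); [right | left].
  apply: main => [_ [->|->]|G sG SG].
  + by exists (idealM H1 Hj), A.
  + exists (idealM H2 Hk), (pi2 * pik); split=> //.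
    by apply: (square_mod_unit_cancel sK AN0 _ KA); rewrite -PE'.
  + have GA : in_subgroup k G A by apply: (inG _ _ _ SA); apply: SG; left.
    split=> //; rewrite PE'; apply: in_subgroupM => //.
    by apply: (inG _ _ _ S2k); apply: SG; right.
- move=> /(sq_unit _ (natN0 _ pp1)) kp1.
  have Kp2 : square_mod_unit K3 p2%:R.
    apply: (square_mod_unit_cancel sK (natCN0 _ pp1)); last exact: square_mod_unit_sub kK kp1.
    by rewrite -natrM.
  (* Since p2 is a square up to a unit of K3, pi1 pi3 and pi1 pi4 agree modulo units and squares
     there; one of them is A, so both capitulate. *)
  have K1314 : square_mod_unit K3 (pi1 * pi3 * (pi1 * pi4)).
    have -> : pi1 * pi3 * (pi1 * pi4) = pi1 ^+ 2 * p2%:R by rewrite -p2C; ring.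
    by apply: square_mod_unitM => //; apply: sqrK; apply: kK.
  have [K13 K14] : square_mod_unit K3 (pi1 * pi3) /\ square_mod_unit K3 (pi1 * pi4).
    move: KA; rewrite /A /pij; case: (j) => KA; split=> //.
      by rewrite mulrC in K1314; apply: (square_mod_unit_cancel sK _ K1314) KA; rewrite mulf_neq0.
    by apply: (square_mod_unit_cancel sK _ K1314) KA; rewrite mulf_neq0.
  apply: main => [_ [->|->]|G sG SG].
  + by exists (idealM H1 H3), (pi1 * pi3).
  + by exists (idealM H1 H4), (pi1 * pi4).
  + have G13 : in_subgroup k G (pi1 * pi3) by apply: (inG _ _ _ S13); apply: SG; left.
    have G14 : in_subgroup k G (pi1 * pi4) by apply: (inG _ _ _ S14); apply: SG; right.
    split; first by rewrite /A /pij; case: (j).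
    apply: (inP _ _ sG (in_subgroupM sk sG G13 G14)).
    have -> : pi1 * pi3 * (pi1 * pi4) * P%:R = (pi1 * p2%:R) ^+ 2 * p1%:R.
      by rewrite PE -p1C -p2C; ring.
    by apply: square_mod_unitM => //; apply: sqrk; subfield.
- move=> /(sq_unit _ (natN0 _ pp2)) kp2.
  have Kp1 : square_mod_unit K3 p1%:R.
    apply: (square_mod_unit_cancel sK (natCN0 _ pp2)); last exact: square_mod_unit_sub kK kp2.
    by rewrite -natrM mulnC.
  (* Here p2 is a square up to a unit already in k, so H1 H3 and H1 H4 have the same class whichever
     of them [j] selects. *)
  have k1314 : square_mod_unit k (pi1 * pi3 * (pi1 * pi4)).
    have -> : pi1 * pi3 * (pi1 * pi4) = pi1 ^+ 2 * p2%:R by rewrite -p2C; ring.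
    by apply: square_mod_unitM => //; apply: sqrk.
  have K13 : square_mod_unit K3 (pi1 * pi3).
    move: KA; rewrite /A /pij; case: (j) => // KA.
    have := square_mod_unit_sub kK k1314; rewrite mulrC => K1314.
    by apply: (square_mod_unit_cancel sK _ K1314) KA; rewrite mulf_neq0.
  have K23 : square_mod_unit K3 (pi2 * pi3).
    apply: (square_mod_unit_cancel sK _ _ K13); first by rewrite mulf_neq0.
    have -> : pi1 * pi3 * (pi2 * pi3) = pi3 ^+ 2 * p1%:R by rewrite -p1C; ring.
    by apply: square_mod_unitM => //; apply: sqrK; apply: kK.
  apply: main => [_ [->|->]|G sG SG].
  + by exists (idealM H1 H3), (pi1 * pi3).
  + by exists (idealM H2 H3), (pi2 * pi3).
  + have G13 : in_subgroup k G (pi1 * pi3) by apply: (inG _ _ _ S13); apply: SG; left.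
    have G23 : in_subgroup k G (pi2 * pi3) by apply: (inG _ _ _ S23); apply: SG; right.
    split.
      rewrite /A /pij; case: (j) => //; exists (idealM H1 H4) => //.
      exact: (in_subgroup_class sk G13 S14 k1314).
    apply: (inP _ _ sG (in_subgroupM sk sG G13 G23)).
    have -> : pi1 * pi3 * (pi2 * pi3) * P%:R = (p1%:R * pi3) ^+ 2 * p2%:R.
      by rewrite PE -p1C -p2C; ring.
    by apply: square_mod_unitM => //; apply: sqrk; subfield.
Qed.
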